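(* Let $N\ge1$, $\underline d\in\mathbb N^{N+1}$, and let $\underline d'=(d'_0\le\dots\le d'_N)$ be its weakly increasing reordering. Consider the quadratic integer program $$\min\ G_{\underline d}(\underline e)=\sum_{1\le j\le i\le N}e_i\,(e_j+d'_j-d'_{j-1})\quad\text{over }\underline e=(e_1,\dots,e_N)\in\mathbb N^N\text{ with }\sum_{i=1}^Ne_i=d'_0.$$ Then the codimension in $\mathrm{Rep}_{\underline d}$ of $\Sigma^0_{\underline d}$ (i.e. of its top-dimensional irreducible components) equals the minimum value of this program, and the number of top-dimensional irreducible components of $\Sigma^0_{\underline d}$ equals the number of $\underline e$ at which the minimum is attained.
   Context: Work over $\mathbb C$. $\mathrm{Rep}_{\underline d}=\prod_{i=1}^N\mathrm{Mat}_{d_i,d_{i-1}}$ is the space of tuples $A_*=(A_1,\dots,A_N)$ with $A_i$ a $d_i\times d_{i-1}$ matrix, and $\Sigma^0_{\underline d}=\{A_*\in\mathrm{Rep}_{\underline d}: A_NA_{N-1}\cdots A_1=0\}$. *)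

(* Defs.v *)
From HB Require Import structures.
From mathcomp Require Import all_boot all_order all_algebra.
From mathcomp Require Import complex.
From mathcomp Require Import Rstruct.
Unset Printing Implicit Defensive.
Import Order.TTheory GRing.Theory Num.Theory.
Local Open Scope ring_scope.

Definition C : fieldType := (Rdefinitions.R)[i].

Inductive pexpr (I : Type) : Type :=
| PConst : C -> pexpr I
| PVar of I
| PAdd of pexpr I & pexpr I
| PMul of pexpr I & pexpr I.

Fixpoint peval {I : Type} (p : pexpr I) (x : I -> C) : C :=
  match p with
  | PConst c => c
  | PVar i => x i
  | PAdd p q => peval p x + peval q x
  | PMul p q => peval p x * peval q x
  end.
Arguments PConst {I}. Arguments PVar {I}. Arguments PAdd {I}. Arguments PMul {I}.


Definition aset (I : Type) := (I -> C) -> Prop.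

Definition asubset {I : Type} (A B : aset I) := forall x, A x -> B x.
Definition aproper {I : Type} (A B : aset I) := asubset A B /\ ~ asubset B A.

Definition zclosed {I : Type} (Z : aset I) :=
  exists S : pexpr I -> Prop, forall x, Z x <-> (forall p, S p -> peval p x = 0).

Definition zirreducible {I : Type} (Z : aset I) :=
  zclosed Z /\ (exists x, Z x) /\
  forall Z1 Z2 : aset I, zclosed Z1 -> zclosed Z2 ->
    (forall x, Z x <-> (Z1 x \/ Z2 x)) -> asubset Z Z1 \/ asubset Z Z2.

Definition irr_chain {I : Type} (X : aset I) (n : nat) :=
  exists Z : nat -> aset I,
    (forall k, (k <= n)%N -> zirreducible (Z k) /\ asubset (Z k) X) /\
    (forall k, (k < n)%N -> aproper (Z k) (Z k.+1)).

Definition zdim {I : Type} (X : aset I) (n : nat) :=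
  irr_chain X n /\ ~ irr_chain X n.+1.

Definition irr_component {I : Type} (X : aset I) (Z : aset I) :=
  zirreducible Z /\ asubset Z X /\
  forall Z', zirreducible Z' -> asubset Z' X -> asubset Z Z' -> asubset Z' Z.

(* The dimension vector d = (d_0, ..., d_N) is given as d : nat -> nat; only d 0, ..., d N matter. *)

(* Coordinates of Rep_d: an entry (k,l) of the matrix A_{i+1} (size d_{i+1} x d_i), for i < N. *)
Definition rep_coord (N : nat) (d : nat -> nat) : finType :=
  {i : 'I_N & ('I_(d i.+1) * 'I_(d i))%type}.

(* Entry (k,l) of the matrix A_{i+1} of the point x (0 outside the range). *)
Definition rep_entry {N : nat} {d : nat -> nat} (x : rep_coord N d -> C)
  (i k l : nat) : C :=
  if [pick c : rep_coord N d | [&& (val (tag c) == i), (val (tagged c).1 == k)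
        & (val (tagged c).2 == l)]] is Some c then x c else 0.

Definition rep_mx {N : nat} {d : nat -> nat} (x : rep_coord N d -> C) (i : nat)
  : 'M[C]_(d i.+1, d i) := \matrix_(k, l) rep_entry x i k l.

Fixpoint rep_prod {N : nat} {d : nat -> nat} (x : rep_coord N d -> C) (i : nat)
  : 'M[C]_(d i, d 0) :=
  match i with
  | 0 => 1%:M
  | i'.+1 => rep_mx x i' *m rep_prod x i'
  end.

Definition Rep (N : nat) (d : nat -> nat) : aset (rep_coord N d) := fun _ => True.
Definition Sigma0 (N : nat) (d : nat -> nat) : aset (rep_coord N d) :=
  fun x => rep_prod x N = 0.

Definition dsort (N : nat) (d : nat -> nat) (j : nat) : nat :=
  nth 0%N (sort leq [seq d i | i <- iota 0 N.+1]) j.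

(* e = (e_1, ..., e_N) is stored as e : 'I_N -> nat with e_{i+1} = e i.
   G_d(e) = sum_{1 <= j <= i <= N} e_i (e_j + d'_j - d'_{j-1}). *)
Definition Gd (N : nat) (d : nat -> nat) (e : 'I_N -> nat) : nat :=
  (\sum_(i < N) \sum_(j < N | (j <= i)%N)
      e i * (e j + (dsort N d j.+1 - dsort N d j)))%N.

Definition feasible (N : nat) (d : nat -> nat) (e : 'I_N -> nat) : Prop :=
  (\sum_(i < N) e i)%N = dsort N d 0.

Definition is_min_value (N : nat) (d : nat -> nat) (m : nat) : Prop :=
  (exists e : 'I_N -> nat, feasible N d e /\ Gd N d e = m) /\
  (forall e : 'I_N -> nat, feasible N d e -> (m <= Gd N d e)%N).

(* The set of minimizers, encoded in the finite type of functions 'I_N -> 'I_(d'_0 + 1)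
   (any feasible e has all entries <= d'_0). *)
Definition minimizers (N : nat) (d : nat -> nat) (m : nat)
  : {set {ffun 'I_N -> 'I_(dsort N d 0).+1}} :=
  [set e : {ffun 'I_N -> 'I_(dsort N d 0).+1} | ((\sum_(i < N) (e i : nat))%N == dsort N d 0) && (Gd N d (fun i => (e i : nat)) == m)].

(* Main.v *)
Require Import Defs.
From HB Require Import structures.
From mathcomp Require Import all_boot all_order all_algebra.
From mathcomp Require Import complex Rstruct zify.
From Stdlib Require Import Classical ClassicalEpsilon FunctionalExtensionality PropExtensionality.
Set Implicit Arguments. Unset Strict Implicit. Unset Printing Implicit Defensive.
Import Order.TTheory GRing.Theory Num.Theory.

(** Stratify the zero-product variety by the ranks r_i of A_i ... A_1, where
    d_0 = r_0 >= r_1 >= ... >= r_N = 0 and r_i <= d_i.  The closure of a stratum is the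
    closure of the image of an affine space under the polynomial map
    A_i = (1 + X_i) T_i (1 - X_{i-1}), where X_i has support in rows >= r_i and columns
    < r_i, and T_i maps the first r_{i-1} basis vectors into the span of the first r_i
    ones.  This map has a rational left inverse, so the closure is irreducible of
    codimension sum_i (d_i - r_i) (r_{i-1} - r_i), which for sorted d is G_d(e) with
    e_i = r_{i-1} - r_i.  The top-dimensional components are therefore counted by the
    minimizing rank sequences.

    The minimum of this codimension and the number of minimizers are invariant under
    permutations of d: for an exchange of d_0 and d_1 this is clear, and for an exchange
    of d_i = p and d_{i+1} = q with r_{i-1}, r_{i+1} fixed, the codimension is a quadratic
    polynomial in r_i whose minimizers are translated by q - p or are unique.

    Dimensions are bounded above by counting monomials: a chain of n + 1 irreducible
    closed sets yields n algebraically independent polynomials on the largest one. *)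

(** * Minimal codimension over rank sequences *)

(** Equality of the lowest-order terms of the two generating functions: when [f] and [g] count
    objects by codimension, the minimal codimensions and the numbers of minimizers agree. *)
Definition eqlead (f g : nat -> nat) :=
  forall v, (forall w, w < v -> f w = 0 /\ g w = 0) -> f v = g v.

Definition conv (f g : nat -> nat) (v : nat) :=
  \sum_(i < v.+1) f i * g (v - i).

Lemma eqlead_sym f g : eqlead f g -> eqlead g f.
Proof. by move=> H v Hv; rewrite H // => w /Hv []. Qed.

Lemma eqlead_ext f f' g g' : f =1 f' -> g =1 g' -> eqlead f g -> eqlead f' g'.
Proof.
by move=> ff gg H v Hv; rewrite -ff -gg; apply: H => w /Hv; rewrite ff gg.
Qed.

Lemma eqlead_eq0 f g v : eqlead f g ->
  (forall w, w < v -> g w = 0) -> (forall w, w < v -> f w = 0).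
Proof.
move=> H g0; elim/ltn_ind => w IH wv; rewrite H; first exact: g0.
by move=> u uw; rewrite IH ?g0 // (ltn_trans uw).
Qed.

Lemma eqlead_trans f g h : eqlead f g -> eqlead g h -> eqlead f h.
Proof.
move=> fg gh v Hv.
have g0 := eqlead_eq0 (eqlead_sym fg) (fun w wv => proj1 (Hv w wv)).
by rewrite fg ?gh // => w wv; rewrite g0 //; case: (Hv w wv).
Qed.

(** Natural numbers do not cancel: a sum that vanishes below [v] has all its terms vanishing
    there. *)
Lemma eqlead_sum (T : eqType) (s : seq T) (f g : T -> nat -> nat) :
  (forall i, i \in s -> eqlead (f i) (g i)) ->
  eqlead (fun v => \sum_(i <- s) f i v) (fun v => \sum_(i <- s) g i v).
Proof.
elim: s => [|i s IH] H v; first by rewrite !big_nil.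
rewrite !big_cons => Hv.
rewrite (H i (mem_head _ _)) ?IH // => [j js|w /Hv|w /Hv].
- by apply: H; rewrite inE js orbT.
- by rewrite !big_cons; lia.
- by rewrite !big_cons; lia.
Qed.

Lemma conv_eq0 f h w u : conv f h (w + u) = 0 -> h u <> 0 -> f w = 0.
Proof.
have lt : w < (w + u).+1 by rewrite ltnS leq_addr.
rewrite /conv (bigD1 (Ordinal lt)) //= addKn => /eqP.
by rewrite addn_eq0 muln_eq0 => /andP[/orP[/eqP|/eqP]].
Qed.

(** If [h (v - i)] is nonzero, then for [w < i] the value [f w] enters the coefficient at
    [w + (v - i) < v], which is zero. So [f] and [g] vanish below [i] and agree at [i]. *)
Lemma eqlead_conv f g h : eqlead f g -> eqlead (conv f h) (conv g h).
Proof.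
move=> fg v Hv; apply: eq_bigr => i _.
case: (eqVneq (h (v - i)) 0) => [->|/eqP hn0]; first by rewrite !muln0.
congr (_ * _); apply: fg => w wi.
have iv := ltn_ord i.
have {Hv}[|F G] := Hv (w + (v - i)); first lia.
by split; [apply: conv_eq0 F hn0|apply: conv_eq0 G hn0].
Qed.

Definition shiftf k (f : nat -> nat) v := if k <= v then f (v - k) else 0.

Lemma shiftf_conv k f : shiftf k f =1 conv (fun v => v == k) f.
Proof.
move=> v; rewrite /shiftf /conv; case: leqP => kv.
  rewrite (bigD1 (Ordinal (kv : k < v.+1))) //= eqxx mul1n big1 ?addn0 // => i.
  by rewrite -val_eqE /= => /negbTE ->.
rewrite big1 // => i _; have iv := ltn_ord i.
by case: eqP => // ik; lia.
Qed.

Lemma shiftf_shiftf j k f : shiftf j (shiftf k f) =1 shiftf (j + k) f.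
Proof.
move=> v; rewrite /shiftf; case: (leqP j v) => jv; last by case: leqP => //; lia.
case: (leqP k (v - j)) => kv; last by case: leqP => //; lia.
by case: leqP; [rewrite subnDA | lia].
Qed.

Lemma eqlead_shiftf k f g : eqlead f g -> eqlead (shiftf k f) (shiftf k g).
Proof.
move=> fg v Hv; rewrite /shiftf; case: leqP => // kv; apply: fg => w wv.
have [|] := Hv (w + k); first lia.
by rewrite /shiftf leq_addl addnK.
Qed.

Lemma conv_suml (T : Type) (s : seq T) (P : pred T) (f : T -> nat -> nat) g v :
  conv (fun u => \sum_(i <- s | P i) f i u) g v = \sum_(i <- s | P i) conv (f i) g v.
Proof.
rewrite /conv exchange_big /=; apply: eq_bigr => i _.
by rewrite big_distrl.
Qed.

(* Counts rank sequences by codimension v; a is the rank reached so far. *)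
Fixpoint nstrata (a : nat) (ds : seq nat) (v : nat) : nat :=
  match ds with
  | [::] => (a == 0) && (v == 0)
  | d :: ds' => \sum_(r <- iota 0 (minn a d).+1)
                  shiftf ((d - r) * (a - r)) (nstrata r ds') v
  end.

Lemma eqlead_nstrata_cons ds ds' d a :
  (forall a, eqlead (nstrata a ds) (nstrata a ds')) ->
  eqlead (nstrata a (d :: ds)) (nstrata a (d :: ds')).
Proof. by move=> H; apply: eqlead_sum => r _; apply: eqlead_shiftf. Qed.

(** The first cost [(d - r) * (a - r)] and the range of [r] are symmetric in [a] and [d]. *)
Lemma nstrata_swap01 p q ds : nstrata p (q :: ds) =1 nstrata q (p :: ds).
Proof.
by move=> v /=; rewrite minnC; apply: eq_bigr => r _; rewrite mulnC.
Qed.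

(** Codimension contributed by two consecutive rank drops, from [a] to [r] in dimension [p] and from
    [r] to [c] in dimension [q]. *)
Definition cost2 (a c p q r : nat) := (p - r) * (a - r) + (q - c) * (r - c).

Definition ncost2 (a c p q v : nat) :=
  \sum_(r <- iota 0 (minn a p).+1 | c <= r) (v == cost2 a c p q r).

Lemma ncost2_count a c p q v :
  ncost2 a c p q v = size [seq r <- iota 0 (minn a p).+1 | (c <= r) && (v == cost2 a c p q r)].
Proof.
rewrite /ncost2 size_filter -sum1_count big_mkcondr /=.
by apply: eq_bigr => r _; case: eqP.
Qed.

Lemma cost2_shift a c p q r : c <= r -> r <= p -> p <= q -> q - p + r <= a ->
  cost2 a c q p (q - p + r) = cost2 a c p q r.
Proof.
move=> cr rp pq ra; rewrite /cost2.
have -> : q - (q - p + r) = p - r by lia.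
have -> : a - r = (a - (q - p + r)) + (q - p) by lia.
have -> : q - c = (p - r) + (r - c) + (q - p) by lia.
have -> : p - c = (p - r) + (r - c) by lia.
have -> : q - p + r - c = (r - c) + (q - p) by lia.
move: (p - r) (r - c) (q - p) (a - (q - p + r)) => A B W Z.
by rewrite !mulnDl !mulnDr; lia.
Qed.

(* The translation r |-> r + q - p preserves the cost and, by strict convexity, maps
   minimizers to minimizers as soon as q - p <= a - c. *)
Lemma eqlead_ncost2_le a c p q : c <= a -> c <= p -> p <= q ->
  eqlead (ncost2 a c p q) (ncost2 a c q p).
Proof.
move=> ca cp pq v Hv.
(* A smaller cost would make a count nonzero below [v]. *)
have lb r : c <= r -> r <= a -> r <= p -> v <= cost2 a c p q r.
  move=> cr ra rp; rewrite leqNgt; apply/negP => /Hv [+ _].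
  rewrite ncost2_count => /size0nil/eqP; rewrite -[_ == _]negbK -has_filter.
  move/negP; apply; apply/hasP; exists r; last by rewrite cr eqxx.
  by rewrite mem_iota; lia.
have lb' r : c <= r -> r <= a -> r <= q -> v <= cost2 a c q p r.
  move=> cr ra rp; rewrite leqNgt; apply/negP => /Hv [_].
  rewrite ncost2_count => /size0nil/eqP; rewrite -[_ == _]negbK -has_filter.
  move/negP; apply; apply/hasP; exists r; last by rewrite cr eqxx.
  by rewrite mem_iota; lia.
rewrite !ncost2_count.
case: (leqP (q - p) (a - c)) => D.
- rewrite -(size_map (addn (q - p))); apply: perm_size; apply: uniq_perm.
  + by rewrite map_inj_uniq ?filter_uniq ?iota_uniq //; apply: addnI.
  + by rewrite filter_uniq ?iota_uniq.
  move=> y; apply/mapP/idP.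
  + case=> r; rewrite !mem_filter !mem_iota => /andP[/andP[cr /eqP vr] rb] ->.
    have rp : r <= p by lia. have ra : r <= a by lia.
    (* Otherwise [r.-1] would be admissible and strictly cheaper than the minimizer [r]. *)
    have ra' : q - p + r <= a.
      rewrite leqNgt; apply/negP => lt.
      have := lb r.-1; rewrite vr /cost2.
      have [r' Er] : exists r', r = r'.+1 by exists r.-1; lia.
      move=> H; have {H}:= H _ _ _.
      rewrite Er /=; nia.
    apply/andP; split; last lia.
    apply/andP; split; first lia.
    by rewrite vr cost2_shift.
  + rewrite mem_filter mem_iota => /andP[/andP[cr /eqP vr] rb].
    have cy : c + (q - p) <= y.
      rewrite leqNgt; apply/negP => lt.
      have := lb' y.+1; rewrite vr /cost2.
      move=> H; have {H}:= H _ _ _.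
      clear -lt D cr rb cp pq ca; nia.
    exists (y - (q - p)); last lia.
    rewrite mem_filter mem_iota; apply/andP; split; last lia.
    apply/andP; split; first lia.
    rewrite vr -[X in _ == X]cost2_shift; try lia.
    by have -> : q - p + (y - (q - p)) = y by lia.
(* For [a - c < q - p] each order has a single candidate for a minimizer, [r = c] in one and [r = a]
   in the other, both of cost [(p - c) * (a - c)]. *)
- have E1 : [seq r <- iota 0 (minn a p).+1 | (c <= r) && (v == cost2 a c p q r)] =i
            [seq r <- [:: c] | v == (p - c) * (a - c)].
    move=> r; rewrite !mem_filter mem_iota inE.
    apply/andP/andP.
    + case=> /andP[cr /eqP vr] rb.
      have rc : r = c.
        have := lb c (leqnn c) ca cp; rewrite vr /cost2 subnn muln0 addn0.
        have [z Ez] : exists z, r = c + z by exists (r - c); lia.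
        have [x Ex] : exists x, p = r + x by exists (p - r); lia.
        have [y Ey] : exists y, a = r + y by exists (a - r); lia.
        have [w Ew] : exists w, q = p + w by exists (q - p); lia.
        subst; clear lb lb' Hv; case: z => [|z] in cr rb D ca cp pq *; first by rewrite addn0.
        nia.
      by rewrite rc eqxx vr rc /cost2 subnn muln0 addn0 eqxx.
    + case=> /eqP vr /eqP ->; rewrite leqnn vr /cost2 subnn muln0 addn0 eqxx; split=> //; lia.
  have E2 : [seq r <- iota 0 (minn a q).+1 | (c <= r) && (v == cost2 a c q p r)] =i
            [seq r <- [:: a] | v == (p - c) * (a - c)].
    move=> r; rewrite !mem_filter mem_iota inE.
    apply/andP/andP.
    + case=> /andP[cr /eqP vr] rb.
      have ra : r = a.
        have aq : a <= q by lia.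
        have := lb' a ca (leqnn a) aq; rewrite vr /cost2 subnn muln0 add0n.
        have [z Ez] : exists z, a = r + z by exists (a - r); lia.
        have [y Ey] : exists y, r = c + y by exists (r - c); lia.
        have [x Ex] : exists x, p = c + x by exists (p - c); lia.
        have [w Ew] : exists w, q = p + (a - c) + w.+1 by exists (q - p - (a - c)).-1; lia.
        subst; clear E1 lb lb' Hv; case: z => [|z] in cr rb D ca cp pq aq *; first by rewrite addn0.
        nia.
      by rewrite ra eqxx vr ra /cost2 subnn muln0 add0n eqxx.
    + case=> /eqP vr /eqP ->; rewrite ca vr /cost2 subnn muln0 add0n eqxx; split=> //; lia.
  rewrite (perm_size (uniq_perm _ _ E1)) ?filter_uniq ?iota_uniq //.
  rewrite (perm_size (uniq_perm _ _ E2)) ?filter_uniq ?iota_uniq //.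
  by rewrite !size_filter.
Qed.

Lemma eqlead_ncost2 a c p q : c <= a -> c <= p -> c <= q ->
  eqlead (ncost2 a c p q) (ncost2 a c q p).
Proof.
move=> ca cp cq; case: (leqP p q) => [pq|/ltnW qp]; first exact: eqlead_ncost2_le.
exact/eqlead_sym/eqlead_ncost2_le.
Qed.

Lemma nstrata_consE a d ds v : nstrata a (d :: ds) v =
  \sum_(0 <= r < (minn a d).+1) shiftf ((d - r) * (a - r)) (nstrata r ds) v.
Proof. by []. Qed.

(** Summing over the final rank [c] on the outside isolates the order of [p] and [q] in the factor
    [ncost2 a c p q]; the range of [c] and the other factor are symmetric. *)
Lemma nstrata_cons2 a p q ds v :
  nstrata a (p :: q :: ds) v =
  \sum_(0 <= c < (minn a (minn p q)).+1) conv (ncost2 a c p q) (nstrata c ds) v.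
Proof.
transitivity (\sum_(0 <= c < (minn a (minn p q)).+1)
    \sum_(0 <= r < (minn a p).+1 | c <= r) shiftf (cost2 a c p q r) (nstrata c ds) v).
  rewrite (exchange_big_dep predT) // nstrata_consE; apply: eq_big_nat => r /andP[_ ra].
  rewrite [RHS]big_nat_cond.
  transitivity (\sum_(0 <= c < (minn r q).+1) shiftf (cost2 a c p q r) (nstrata c ds) v).
    rewrite {1}/shiftf nstrata_consE; case: leqP => rv; last first.
      rewrite big1 // => c _; rewrite /shiftf; case: leqP => // cv.
      by have := leq_trans (leq_addr _ _) cv; rewrite leqNgt rv.
    apply: eq_bigr => c _; rewrite -shiftf_shiftf /shiftf rv //.
  rewrite (@big_nat_widen _ _ _ 0 _ (minn a (minn p q)).+1); last lia.
  rewrite big_nat_cond; apply: eq_bigl => c; lia.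
apply: eq_bigr => c _; rewrite conv_suml; apply: eq_bigr => r _.
exact: shiftf_conv.
Qed.

Lemma eqlead_nstrata_swap a p q ds :
  eqlead (nstrata a (p :: q :: ds)) (nstrata a (q :: p :: ds)).
Proof.
apply: (eqlead_ext (fun v => esym (nstrata_cons2 a p q ds v))
                   (fun v => esym (nstrata_cons2 a q p ds v))).
rewrite [minn q p]minnC; apply: eqlead_sum => c; rewrite mem_index_iota => cb.
by apply: eqlead_conv; apply: eqlead_ncost2; lia.
Qed.

(** The head [y] of [t] is brought behind the head [x] of the first list, the two are exchanged, and
    the tails are compared. The induction is on a length bound because it is also applied to
    [x :: u], which is not a tail of the first list. *)
Lemma eqlead_nstrata_perm_tail n s t a : size s <= n ->
  perm_eq s t -> eqlead (nstrata a s) (nstrata a t).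
Proof.
elim: n s t a => [|n IH] [|x s] t a //= sn st.
- by have -> : t = [::] by apply/nilP; rewrite /nilp -(perm_size st).
- by have -> : t = [::] by apply/nilP; rewrite /nilp -(perm_size st).
case: t st => [|y t] st; first by have := perm_size st.
case: (eqVneq x y) st => [<-|xy] st.
  by apply: eqlead_nstrata_cons => b; apply: IH; rewrite ?perm_cons // in st *.
have ys : y \in s.
  by have := perm_mem st y; rewrite !inE eqxx [y == x]eq_sym (negbTE xy).
have syu := perm_to_rem ys; set u := rem y s in syu.
have tu : perm_eq t (x :: u).
  rewrite -(perm_cons y); apply: (@perm_trans _ (x :: s)); first by rewrite perm_sym.
  apply: (@perm_trans _ (x :: y :: u)); first by rewrite perm_cons.
  by apply/permPl; apply: (perm_catCA [:: x] [:: y] u).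
have st' : size s = size t by have := perm_size st; case.
apply: (@eqlead_trans _ (nstrata a (x :: y :: u))).
  by apply: eqlead_nstrata_cons => b; apply: IH.
apply: (@eqlead_trans _ (nstrata a (y :: x :: u))).
  exact: eqlead_nstrata_swap.
apply: eqlead_nstrata_cons => b; apply: IH; last by rewrite perm_sym.
by rewrite -(perm_size tu) -st'.
Qed.

(** The entry [b] is brought to the front of [s], where the exact symmetry [nstrata_swap01]
    exchanges it with [a]. *)
Lemma eqlead_nstrata_perm a s b t :
  perm_eq (a :: s) (b :: t) -> eqlead (nstrata a s) (nstrata b t).
Proof.
case: (eqVneq a b) => [<-|ab] st.
  by apply: (eqlead_nstrata_perm_tail (leqnn _)); rewrite perm_cons in st.
have ys : b \in s.
  by have := perm_mem st b; rewrite !inE eqxx [b == a]eq_sym (negbTE ab).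
have syu := perm_to_rem ys; set u := rem b s in syu.
have tu : perm_eq (a :: u) t.
  rewrite -(perm_cons b) perm_sym; apply: perm_trans (_ : perm_eq (a :: s) _).
    by rewrite perm_sym.
  apply: (@perm_trans _ (a :: b :: u)); first by rewrite perm_cons.
  by apply/permPl; apply: (perm_catCA [:: a] [:: b] u).
apply: (@eqlead_trans _ (nstrata a (b :: u))).
  exact: (eqlead_nstrata_perm_tail (leqnn _) syu).
apply: (eqlead_ext (fun v => esym (nstrata_swap01 a b u v)) (frefl _)).
exact: (eqlead_nstrata_perm_tail (leqnn _) tu).
Qed.

(** * Rank sequences and the quadratic program of the sorted dimension vector *)

Fixpoint rank_seqs (a : nat) (ds : seq nat) : seq (seq nat) :=
  match ds with
  | [::] => if a == 0 then [:: [::]] else [::]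
  | d :: ds' => [seq r :: rs | r <- iota 0 (minn a d).+1, rs <- rank_seqs r ds']
  end.

Definition rank_codim (N : nat) (d r : nat -> nat) :=
  \sum_(i < N) (d i.+1 - r i.+1) * (r i - r i.+1).

Lemma uniq_rank_seqs a ds : uniq (rank_seqs a ds).
Proof.
elim: ds a => [|d ds IH] a; first by rewrite /=; case: ifP.
apply: (@allpairs_uniq_dep nat (fun=> seq nat) (seq nat) cons
  (iota 0 (minn a d).+1) (fun r => rank_seqs r ds)); first exact: iota_uniq.
  by move=> r _; apply: IH.
by case=> [r rs] [r' rs'] _ _ /= [-> ->].
Qed.

Lemma mem_rank_seqs a ds rs (r := nth 0 (a :: rs)) :
  rs \in rank_seqs a ds <->
  [/\ size rs = size ds,
      forall i, i < size ds -> r i.+1 <= r i,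
      forall i, i < size ds -> r i.+1 <= nth 0 ds i
    & r (size ds) = 0].
Proof.
rewrite {}/r; elim: ds a rs => [|d ds IH] a rs.
  case: rs => [|x rs] /=; case: eqP => a0.
  - by split=> // _; split.
  - by split=> // -[_ _ _ /a0].
  - by split=> [|[]//]; rewrite inE.
  - by split=> // -[].
split.
  move=> /allpairsPdep [r [rs' [rb /IH [sz H1 H2 H3] ->]]].
  move: rb; rewrite mem_iota => rb.
  split; [by rewrite /= sz | move=> [|i] /= lt; [lia|exact: H1]
    | move=> [|i] /= lt; [lia|exact: H2] | exact: H3].
case: rs => [[]//|x rs] [[sz] H1 H2 H3].
apply/allpairsPdep; exists x, rs; split=> //.
  by rewrite mem_iota /=; have := H1 0 isT; have := H2 0 isT => /=; lia.
apply/IH; split=> // i lt; [exact: (H1 i.+1)|exact: (H2 i.+1)].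
Qed.

Lemma count_rank_seqs a ds v :
  count (fun rs => rank_codim (size ds) (nth 0 (a :: ds)) (nth 0 (a :: rs)) == v)
    (rank_seqs a ds) = nstrata a ds v.
Proof.
elim: ds a v => [|d ds IH] a v.
  by rewrite /=; case: eqP => //= _; rewrite /rank_codim big_ord0 addn0 eq_sym.
rewrite nstrata_consE -[rank_seqs a (d :: ds)]/(flatten
  [seq [seq r :: rs | rs <- rank_seqs r ds] | r <- iota 0 (minn a d).+1]).
rewrite count_flatten sumnE 2!big_map; apply: eq_bigr => r _.
rewrite count_map; set k := (d - r) * (a - r).
pose cod rs := rank_codim (size ds) (nth 0 (r :: ds)) (nth 0 (r :: rs)).
transitivity (count (fun rs => k + cod rs == v) (rank_seqs r ds)).
  by apply: eq_count => rs /=; rewrite /rank_codim big_ord_recl.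
rewrite /shiftf; move: k => k; case: leqP => kv.
  by rewrite -IH; apply: eq_count => rs /=; rewrite -{1}(subnKC kv) eqn_add2l.
apply/eqP; rewrite -leqn0 leqNgt -has_count; apply/negP => /hasP[rs _ /eqP].
by move: (cod rs) => c; lia.
Qed.

Section SortedProgram.
Variables (N : nat) (d : nat -> nat).
Let D := dsort N d.

Let Dlist := sort leq [seq d i | i <- iota 0 N.+1].

Let size_Dlist : size Dlist = N.+1.
Proof. by rewrite size_sort size_map size_iota. Qed.

Lemma dsort_mono i j : i <= j -> j <= N -> D i <= D j.
Proof.
move=> ij jN; apply: (sorted_leq_nth leq_trans leqnn 0 (sort_sorted leq_total _)) => //.
  by rewrite inE size_Dlist; lia.
by rewrite inE size_Dlist; lia.
Qed.

Lemma dsort_mkseq : D 0 :: [seq D i.+1 | i <- iota 0 N] = Dlist.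
Proof.
apply: (@eq_from_nth _ 0); first by rewrite /= size_map size_iota size_Dlist.
move=> [|i] //=; rewrite size_map size_iota => iN.
by rewrite (nth_map 0) ?size_iota // nth_iota.
Qed.

Lemma eqlead_nstrata_dsort :
  eqlead (nstrata (d 0) [seq d i.+1 | i <- iota 0 N])
         (nstrata (D 0) [seq D i.+1 | i <- iota 0 N]).
Proof.
apply: eqlead_nstrata_perm; rewrite dsort_mkseq perm_sym perm_sort /=.
by rewrite -[1]/(1 + 0) iotaDl -map_comp.
Qed.

(** The rank left after the first [k] drops [e_1, ..., e_k], starting from [d'_0]; for feasible [e]
    the subtraction is not truncated. *)
Definition rank_of (e : 'I_N -> nat) (k : nat) := D 0 - \sum_(j < N | j < k) e j.

Lemma sum_ordS (F : 'I_N -> nat) (i : 'I_N) :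
  \sum_(j < N | j < i.+1) F j = \sum_(j < N | j < i) F j + F i.
Proof.
rewrite (bigD1 i) //= addnC; congr (_ + _); apply: eq_bigl => j.
by rewrite ltnS andbC -val_eqE ltn_neqAle.
Qed.

Lemma sum_ord_le_total (F : 'I_N -> nat) k :
  \sum_(j < N | j < k) F j <= \sum_(j < N) F j.
Proof. by rewrite [leqRHS](bigID (fun j : 'I_N => j < k)) /= leq_addr. Qed.

Lemma rank_of_diff e (i : 'I_N) : \sum_(j < N) e j = D 0 ->
  rank_of e i = rank_of e i.+1 + e i.
Proof.
move=> eD; rewrite /rank_of sum_ordS.
by have := sum_ord_le_total e i.+1; rewrite sum_ordS eD; lia.
Qed.

Lemma sum_dsort_diff (i : 'I_N) :
  \sum_(j < N | j <= i) (D j.+1 - D j) = D i.+1 - D 0.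
Proof.
have := ltn_ord i; move: (nat_of_ord i) => k kN.
rewrite -(@big_ord_widen _ _ _ k.+1 N (fun j => D j.+1 - D j)) //.
elim: k kN => [|k IH] kN; first by rewrite big_ord_recl big_ord0 addn0.
rewrite big_ord_recr /= IH; last lia.
have := @dsort_mono 0 k.+1 isT; have := @dsort_mono k.+1 k.+2 (leqnSn _); lia.
Qed.

(** With [i] counted from 1, the inner sum telescopes to [e_1 + ... + e_i + d'_i - d'_0 = d'_i -
    r_i], and [e_i] is the drop [r_{i-1} - r_i]. *)
Lemma Gd_rank_codim e : feasible N d e -> Gd N d e = rank_codim N D (rank_of e).
Proof.
move=> fe; apply: eq_bigr => i _.
rewrite -big_distrr /= big_split /= sum_dsort_diff mulnC; congr (_ * _); last first.
  by rewrite (rank_of_diff i fe) addKn.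
rewrite /rank_of -[\sum_(j < N | j <= i) e j]/(\sum_(j < N | j < i.+1) e j).
have := sum_ord_le_total e i.+1; rewrite [X in _ <= X](fe : _ = D 0).
have := @dsort_mono 0 i.+1 isT (ltn_ord i).
by move: (\sum_(j < N | j < i.+1) e j) (D 0) (D i.+1) => S D0 Di; lia.
Qed.

Lemma sum_telescope_ord (r : nat -> nat) k : k <= N ->
  (forall i, i < N -> r i.+1 <= r i) ->
  \sum_(j < N | j < k) (r j - r j.+1) = r 0 - r k.
Proof.
move=> kN H.
rewrite -(@big_ord_widen _ _ _ k N (fun j => r j - r j.+1)) //.
suff : \sum_(i < k) (r i - r i.+1) = r 0 - r k /\ r k <= r 0 by case.
elim: k kN => [|k IH] kN; first by rewrite big_ord0 subnn.
rewrite big_ord_recr /=; have [|-> le] := IH; first lia.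
by have := H k kN; lia.
Qed.

(** Feasible vectors correspond to rank sequences through partial sums and successive drops.
    Sortedness makes the constraint [r_i <= d'_i] automatic, because [r_i <= d'_0]. *)
Lemma card_minimizers m : #|minimizers N d m| =
  nstrata (D 0) [seq D i.+1 | i <- iota 0 N] m.
Proof.
set ds := [seq D i.+1 | i <- iota 0 N].
have sds : size ds = N by rewrite size_map size_iota.
have nds i : i < N -> nth 0 ds i = D i.+1.
  by move=> iN; rewrite (nth_map 0) ?size_iota // nth_iota.
rewrite -count_rank_seqs -size_filter cardE.
pose f (e : {ffun 'I_N -> 'I_(D 0).+1}) := mkseq (fun i => rank_of (fun i => e i) i.+1) N.
have fE (e : {ffun 'I_N -> 'I_(D 0).+1}) k : k <= N ->
    nth 0 (D 0 :: f e) k = rank_of (fun i => e i) k.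
  case: k => [|k] kN /=; last by rewrite nth_mkseq.
  by rewrite /rank_of big_pred0 ?subn0.
have codE rs r' : (forall k, k <= N -> nth 0 (D 0 :: rs) k = r' k) ->
    rank_codim (size ds) (nth 0 (D 0 :: ds)) (nth 0 (D 0 :: rs)) = rank_codim N D r'.
  move=> H; rewrite /rank_codim sds; apply: eq_bigr => i _.
  by rewrite !H ?(ltnW (ltn_ord i)) // [nth 0 (_ :: ds) _]/= nds.
rewrite -(size_map f); apply: perm_size; apply: uniq_perm.
- rewrite map_inj_in_uniq ?enum_uniq // => e e'.
  rewrite !mem_enum !inE => /andP[/eqP Se _] /andP[/eqP Se' _] ee.
  apply/ffunP => i; apply: val_inj => /=.
  have H k : k <= N -> rank_of (fun i => e i) k = rank_of (fun i => e' i) k.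
    by move=> kN; rewrite -!fE // ee.
  have := rank_of_diff i Se; rewrite !H ?(ltnW (ltn_ord i)) //.
  by rewrite (rank_of_diff i Se') => /addnI.
- by rewrite filter_uniq ?uniq_rank_seqs.
move=> rs; rewrite mem_filter; apply/mapP/andP.
- case=> e; rewrite mem_enum inE => /andP[/eqP Se /eqP Ge] ->; split.
    by rewrite (codE _ _ (fE e)) -Gd_rank_codim ?Ge.
  apply/mem_rank_seqs; rewrite sds; split; first by rewrite size_mkseq.
  + move=> i iN; rewrite !fE ?(ltnW iN) //.
    by have := rank_of_diff (Ordinal iN) Se => /= ->; apply: leq_addr.
  + move=> i iN; rewrite fE // nds // (leq_trans (leq_subr _ _)) //.
    exact: dsort_mono.
  + rewrite fE // /rank_of (eq_bigl predT) ?Se ?subnn // => j.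
    by rewrite ltn_ord.
- case=> /eqP cm /mem_rank_seqs; rewrite sds; set r := nth 0 (D 0 :: rs).
  case=> sz H1 H2 H3.
  have r0 k : k <= N -> r k <= D 0.
    elim: k => [//|k IH] kN; exact: leq_trans (H1 k kN) (IH (ltnW kN)).
  pose e : {ffun 'I_N -> 'I_(D 0).+1} := [ffun i => inord (r (nat_of_ord i) - r i.+1)].
  have eE (i : 'I_N) : e i = r i - r i.+1 :> nat.
    rewrite ffunE inordK // ltnS (leq_trans (leq_subr _ _)) // r0 //.
    exact: ltnW (ltn_ord i).
  have Se k : k <= N -> \sum_(j < N | j < k) e j = D 0 - r k.
    by move=> kN; under eq_bigr => j _ do rewrite eE; apply: sum_telescope_ord.
  have SN : \sum_(j < N) e j = D 0.
    have := Se N (leqnn N); rewrite H3 subn0; apply: etrans.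
    by apply: eq_bigl => j; apply/esym/ltn_ord.
  have rE k : k <= N -> r k = rank_of (fun i => e i) k.
    by move=> kN; rewrite /rank_of Se // subKn ?r0.
  exists e.
    rewrite mem_enum inE SN eqxx /= Gd_rank_codim // -cm (codE _ _ rE).
    exact: eqxx.
  apply: (@eq_from_nth _ 0); first by rewrite size_mkseq.
  move=> i; rewrite sz => iN; rewrite nth_mkseq // -rE //.
Qed.

End SortedProgram.

Local Open Scope ring_scope.

(** * Polynomial functions *)

Definition polyfun (I : Type) (F : (I -> C) -> C) :=
  exists p : pexpr I, forall x, peval p x = F x.

Definition polymap (J I : Type) (phi : (J -> C) -> I -> C) :=
  forall i, polyfun (fun t => phi t i).

Definition prange (J I : Type) (phi : (J -> C) -> I -> C) : aset I :=
  fun x => exists t, phi t = x.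

Definition zclosure (I : Type) (S : aset I) : aset I :=
  fun x => forall p, (forall y, S y -> peval p y = 0) -> peval p x = 0.

Lemma polyfun_peval (I : Type) (p : pexpr I) : polyfun (peval p).
Proof. by exists p. Qed.

Lemma polyfun_const (I : Type) (c : C) : polyfun (fun _ : I -> C => c).
Proof. by exists (PConst c). Qed.

Lemma polyfun_var (I : Type) (i : I) : polyfun (fun x : I -> C => x i).
Proof. by exists (PVar i). Qed.

Lemma polyfun_ext (I : Type) (F G : (I -> C) -> C) :
  (forall x, F x = G x) -> polyfun F -> polyfun G.
Proof. by move=> FG [p Hp]; exists p => x; rewrite Hp. Qed.

Lemma polyfunD (I : Type) (F G : (I -> C) -> C) :
  polyfun F -> polyfun G -> polyfun (fun x => F x + G x).
Proof. by move=> [p Hp] [q Hq]; exists (PAdd p q) => x /=; rewrite Hp Hq. Qed.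

Lemma polyfunM (I : Type) (F G : (I -> C) -> C) :
  polyfun F -> polyfun G -> polyfun (fun x => F x * G x).
Proof. by move=> [p Hp] [q Hq]; exists (PMul p q) => x /=; rewrite Hp Hq. Qed.

Lemma polyfunB (I : Type) (F G : (I -> C) -> C) :
  polyfun F -> polyfun G -> polyfun (fun x => F x - G x).
Proof.
move=> pF pG; have := polyfunD pF (polyfunM (polyfun_const I (-1)) pG).
by apply: polyfun_ext => x; rewrite mulN1r.
Qed.

Lemma polyfun_sum (I : Type) (K : Type) (s : seq K) (P : pred K)
    (F : K -> (I -> C) -> C) :
  (forall k, P k -> polyfun (F k)) -> polyfun (fun x => \sum_(k <- s | P k) F k x).
Proof.
move=> pF; elim: s => [|k s IH].
  by apply: polyfun_ext (polyfun_const I 0) => x; rewrite big_nil.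
case Pk: (P k); last by apply: polyfun_ext IH => x; rewrite big_cons Pk.
by apply: polyfun_ext (polyfunD (pF k Pk) IH) => x; rewrite big_cons Pk.
Qed.

Lemma polyfun_prod (I : Type) (K : Type) (s : seq K) (P : pred K)
    (F : K -> (I -> C) -> C) :
  (forall k, P k -> polyfun (F k)) -> polyfun (fun x => \prod_(k <- s | P k) F k x).
Proof.
move=> pF; elim: s => [|k s IH].
  by apply: polyfun_ext (polyfun_const I 1) => x; rewrite big_nil.
case Pk: (P k); last by apply: polyfun_ext IH => x; rewrite big_cons Pk.
by apply: polyfun_ext (polyfunM (pF k Pk) IH) => x; rewrite big_cons Pk.
Qed.

Lemma polyfun_comp (J I : Type) (phi : (J -> C) -> I -> C) (F : (I -> C) -> C) :
  polymap phi -> polyfun F -> polyfun (fun t => F (phi t)).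
Proof.
move=> pphi [p Hp]; apply: (@polyfun_ext _ (fun t => peval p (phi t))).
  by move=> t; rewrite Hp.
elim: {Hp} p => [c|i|p IHp q IHq|p IHp q IHq] /=.
- exact: polyfun_const.
- exact: pphi.
- exact: polyfunD.
- exact: polyfunM.
Qed.

(** * Restriction to curves *)

(** Along a curve with polynomial coordinates a polynomial function becomes a univariate polynomial,
    to which root counting applies. *)
Lemma polyfun_curve (I : Type) (F : (I -> C) -> C) (q : I -> {poly C}) :
  polyfun F -> exists P : {poly C}, forall t, P.[t] = F (fun i => (q i).[t]).
Proof.
case=> p Hp; suff [P HP] : exists P : {poly C},
    forall t, P.[t] = peval p (fun i => (q i).[t]).
  by exists P => t; rewrite HP Hp.
elim: {Hp} p => [c|i|p [P HP] r [Q HQ]|p [P HP] r [Q HQ]] /=.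
- by exists c%:P => t; rewrite hornerC.
- by exists (q i).
- by exists (P + Q) => t; rewrite hornerD HP HQ.
- by exists (P * Q) => t; rewrite hornerM HP HQ.
Qed.

Lemma natrC_inj : injective (fun n : nat => n%:R : C).
Proof.
move=> m n /= H; apply/eqP.
by rewrite -(eqr_nat ((Rdefinitions.R)[i] : numDomainType)); apply/eqP.
Qed.

Lemma horner_eq0_all (P : {poly C}) : (forall t, P.[t] = 0) -> P = 0.
Proof.
move=> P0; apply: (@roots_geq_poly_eq0 _ P [seq n%:R | n <- iota 0 (size P)]).
- by apply/allP => x _; rewrite /root P0.
- by rewrite map_inj_uniq ?iota_uniq //; apply: natrC_inj.
- by rewrite size_map size_iota.
Qed.

Lemma horner_neq0_ex (P : {poly C}) : P != 0 -> exists t, P.[t] != 0.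
Proof.
move=> Pn0; apply: NNPP => H; case/negP: Pn0; apply/eqP/horner_eq0_all => t.
by apply: NNPP => /eqP Pt; apply: H; exists t.
Qed.

(** On the line from [u] to [v] both functions are nonzero univariate polynomials, so their product
    has a non-root. In effect, polynomial functions on affine space form an integral domain. *)
Lemma polyfun_common_neq0 (I : Type) (F G : (I -> C) -> C) u v :
  polyfun F -> polyfun G -> F u != 0 -> G v != 0 ->
  exists x, F x != 0 /\ G x != 0.
Proof.
move=> pF pG Fu Gv.
pose q i : {poly C} := (u i)%:P + 'X * (v i - u i)%:P.
have q0 : (fun i => (q i).[0]) = u.
  by apply: functional_extensionality => i; rewrite /q hornerD hornerM hornerX !hornerC mul0r addr0.
have q1 : (fun i => (q i).[1]) = v.
  by apply: functional_extensionality => i; rewrite /q hornerD hornerM hornerX !hornerC mul1r addrC subrK.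
have [P HP] := polyfun_curve q pF; have [Q HQ] := polyfun_curve q pG.
have Pn0 : P != 0.
  by apply: contraNneq Fu => P0; rewrite -q0 -HP P0 horner0.
have Qn0 : Q != 0.
  by apply: contraNneq Gv => Q0; rewrite -q1 -HQ Q0 horner0.
have [t] := horner_neq0_ex (mulf_neq0 Pn0 Qn0).
rewrite hornerM mulf_eq0 negb_or HP HQ => /andP[? ?].
by exists (fun i => (q i).[t]).
Qed.

(** * Closed and irreducible sets *)

Lemma zclosure_closed (I : Type) (S : aset I) : zclosed (zclosure S).
Proof. by exists (fun p => forall y, S y -> peval p y = 0). Qed.

Lemma sub_zclosure (I : Type) (S : aset I) : asubset S (zclosure S).
Proof. by move=> x Sx p; apply. Qed.

Lemma zclosure_poly0 (I : Type) (S : aset I) (F : (I -> C) -> C) :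
  polyfun F -> (forall y, S y -> F y = 0) -> forall x, zclosure S x -> F x = 0.
Proof.
by move=> [p Hp] F0 x Sx; rewrite -Hp; apply: Sx => y Sy; rewrite Hp F0.
Qed.

Lemma zclosureS (I : Type) (S T : aset I) :
  asubset S T -> asubset (zclosure S) (zclosure T).
Proof. by move=> ST x Sx p pT; apply: Sx => y /ST; apply: pT. Qed.

Lemma zclosed_sep (I : Type) (Z : aset I) x : zclosed Z -> ~ Z x ->
  exists p, (forall y, Z y -> peval p y = 0) /\ peval p x <> 0.
Proof.
move=> [S HS] nZx; apply: NNPP => H; apply: nZx; apply/HS => p Sp.
apply: NNPP => px; apply: H; exists p; split=> // y /HS; exact.
Qed.

Lemma zclosed_capV (I : Type) (Z : aset I) p : zclosed Z ->
  zclosed (fun x => Z x /\ peval p x = 0).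
Proof.
move=> [S HS]; exists (fun q => S q \/ q = p) => x; split.
  by case=> /HS Zx px q [/Zx|->].
by move=> H; split; [apply/HS => q Sq; apply: H; left | apply: H; right].
Qed.

(** The ideal of an irreducible set is prime: [Z] is the union of its zero loci of [p] and of
    [q]. *)
Lemma zirreducible_prime (I : Type) (Z : aset I) p q : zirreducible Z ->
  (forall x, Z x -> peval p x * peval q x = 0) ->
  (forall x, Z x -> peval p x = 0) \/ (forall x, Z x -> peval q x = 0).
Proof.
move=> [cZ [_ irrZ]] pq0.
case: (irrZ _ _ (zclosed_capV p cZ) (zclosed_capV q cZ)).
- move=> x; split; last by case=> -[].
  move=> Zx; have /eqP := pq0 x Zx; rewrite mulf_eq0.
  by case/orP => /eqP ?; [left|right].
- by move=> H; left => x /H [].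
- by move=> H; right => x /H [].
Qed.

Lemma asubset_nP (I : Type) (A B : aset I) :
  ~ asubset A B -> exists x, A x /\ ~ B x.
Proof.
move=> H; apply: NNPP => nex; apply: H => x Ax.
by apply: NNPP => nBx; apply: nex; exists x.
Qed.

(** If [Z] lies in no [V r], each [r] in [L] has a polynomial vanishing on [V r] but not on [Z]. The
    product of these vanishes on [Z], against primality. *)
Lemma zirreducible_bigcup (I : Type) (T : eqType) (L : seq T) (V : T -> aset I)
    (Z : aset I) :
  zirreducible Z -> (forall r, zclosed (V r)) ->
  (forall x, Z x -> exists2 r, r \in L & V r x) ->
  exists2 r, r \in L & asubset Z (V r).
Proof.
move=> irrZ cV ZV.
apply: NNPP => H.
have sep r : r \in L -> exists p, (forall y, V r y -> peval p y = 0) /\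
    ~ (forall y, Z y -> peval p y = 0).
  move=> rL; have : ~ asubset Z (V r) by move=> ?; apply: H; exists r.
  move=> /asubset_nP [x [Zx nVx]].
  have [p [pV px]] := zclosed_sep (cV r) nVx.
  by exists p; split=> // /(_ x Zx).
suff [p [pV pZ]] : exists p, (forall r y, r \in L -> V r y -> peval p y = 0) /\
    ~ (forall y, Z y -> peval p y = 0).
  by apply: pZ => y /[dup] Zy /ZV [r rL Vy]; apply: pV rL Vy.
elim: {ZV H} L sep => [_|r L IH sep].
  exists (PConst 1); split=> //= H.
  by case: irrZ => _ [[x Zx] _]; have /eqP := H x Zx; rewrite oner_eq0.
case: IH => [s sL|p [pV pZ]]; first by apply: sep; rewrite inE sL orbT.
have [q [qV qZ]] := sep r (mem_head _ _).
exists (PMul q p); split=> [s y|/(zirreducible_prime irrZ)[]//].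
rewrite inE => /orP[/eqP-> /qV /= ->|sL /(pV _ _ sL) /= ->]; first exact: mul0r.
exact: mulr0.
Qed.

(** Polynomials that separate the closure from [Z1] and from [Z2] pull back to nonzero functions on
    affine space. At a point where neither vanishes, the image lies outside both sets. *)
Lemma zirreducible_zclosure_prange (J I : Type) (phi : (J -> C) -> I -> C) :
  polymap phi -> zirreducible (zclosure (prange phi)).
Proof.
move=> pphi; split; first exact: zclosure_closed; split.
  by exists (phi (fun=> 0)); apply: sub_zclosure; exists (fun=> 0).
move=> Z1 Z2 c1 c2 Z12; apply: NNPP => /not_or_and [n1 n2].
have sep Z : zclosed Z -> ~ asubset (zclosure (prange phi)) Z ->
    exists p t, (forall y, Z y -> peval p y = 0) /\ peval p (phi t) != 0.
  move=> cZ /asubset_nP [x [cx nZx]]; have [p [pZ px]] := zclosed_sep cZ nZx.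
  apply: NNPP => H; apply: px; apply: cx => y [t <-].
  by apply: NNPP => /eqP pt; apply: H; exists p, t.
have [p [u [pZ pu]]] := sep _ c1 n1; have [q [v [qZ qv]]] := sep _ c2 n2.
have [t [pt qt]] := polyfun_common_neq0
  (polyfun_comp pphi (polyfun_peval p)) (polyfun_comp pphi (polyfun_peval q)) pu qv.
have /Z12 [/pZ|/qZ] : zclosure (prange phi) (phi t).
- by apply: sub_zclosure; exists t.
- by apply/eqP.
- by apply/eqP.
Qed.

(** * Upper bound for the dimension: counting monomials *)

Fixpoint pdeg (I : Type) (p : pexpr I) : nat :=
  match p with
  | PConst _ => 0
  | PVar _ => 1
  | PAdd p q => maxn (pdeg p) (pdeg q)
  | PMul p q => pdeg p + pdeg q
  end.

Fixpoint psubst (J I : Type) (s : I -> pexpr J) (p : pexpr I) : pexpr J :=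
  match p with
  | PConst c => PConst c
  | PVar i => s i
  | PAdd p q => PAdd (psubst s p) (psubst s q)
  | PMul p q => PMul (psubst s p) (psubst s q)
  end.

Lemma peval_psubst (J I : Type) (s : I -> pexpr J) p t :
  peval (psubst s p) t = peval p (fun i => peval (s i) t).
Proof. by elim: p => //= p -> q ->. Qed.

Lemma pdeg_psubst (J I : Type) (s : I -> pexpr J) p b :
  (forall i, (pdeg (s i) <= b)%N) -> (pdeg (psubst s p) <= pdeg p * b)%N.
Proof.
move=> sb; elim: p => //= [i|p IHp q IHq|p IHp q IHq].
- by rewrite mul1n.
- rewrite geq_max (leq_trans IHp) ?(leq_trans IHq) //;
  by rewrite leq_mul2r ?leq_maxl ?leq_maxr orbT.
- by rewrite mulnDl leq_add.
Qed.

Section MonomialSpan.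
Variable J : finType.

Definition monom (g : J -> nat) (x : J -> C) : C := \prod_j x j ^+ g j.

(** Bounding each exponent by [D], rather than the total degree, gives the simple count
    [D.+1 ^ #|J|] of monomials. *)
Definition inspan (D : nat) (F : (J -> C) -> C) :=
  exists c : {ffun J -> 'I_D.+1} -> C,
  forall x, F x = \sum_e c e * monom (fun j => e j) x.

Lemma inspan_monom D g : (forall j, (g j <= D)%N) -> inspan D (monom g).
Proof.
move=> gD; exists (fun e => (e == [ffun j => inord (g j)])%:R) => x.
rewrite (bigD1 [ffun j => inord (g j)]) //= eqxx mul1r big1 ?addr0.
  by apply: eq_bigr => j _; rewrite ffunE inordK // ltnS.
by move=> e /negbTE ->; rewrite mul0r.
Qed.

Lemma inspan_ext D F G : (forall x, F x = G x) -> inspan D F -> inspan D G.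
Proof. by move=> FG [c Hc]; exists c => x; rewrite -FG. Qed.

Lemma inspanD D F G : inspan D F -> inspan D G -> inspan D (fun x => F x + G x).
Proof.
move=> [c Hc] [b Hb]; exists (fun e => c e + b e) => x.
by rewrite Hc Hb -big_split /=; apply: eq_bigr => e _; rewrite mulrDl.
Qed.

Lemma inspanZ D a F : inspan D F -> inspan D (fun x => a * F x).
Proof.
move=> [c Hc]; exists (fun e => a * c e) => x.
by rewrite Hc mulr_sumr; apply: eq_bigr => e _; rewrite mulrA.
Qed.

Lemma inspan_sum D (K : Type) (s : seq K) (F : K -> (J -> C) -> C) :
  (forall k, inspan D (F k)) -> inspan D (fun x => \sum_(k <- s) F k x).
Proof.
move=> HF; elim: s => [|k s IH].
  exists (fun=> 0) => x; rewrite big_nil big1 // => e _; exact: mul0r.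
by apply: inspan_ext (inspanD (HF k) IH) => x; rewrite big_cons.
Qed.

Lemma monomM g h x : monom g x * monom h x = monom (fun j => g j + h j)%N x.
Proof. by rewrite -big_split; apply: eq_bigr => j _; rewrite /= exprD. Qed.

Lemma inspanM D1 D2 D F G : (D1 + D2 <= D)%N ->
  inspan D1 F -> inspan D2 G -> inspan D (fun x => F x * G x).
Proof.
move=> DD [c Hc] [b Hb].
apply: (@inspan_ext _ (fun x => \sum_e1 \sum_e2 (c e1 * b e2) *
    monom (fun j => e1 j + e2 j)%N x)).
  move=> x; rewrite Hc Hb mulr_suml; apply: eq_bigr => e1 _.
  by rewrite mulr_sumr; apply: eq_bigr => e2 _; rewrite -monomM mulrACA.
do 2![apply: inspan_sum => ?]; apply: inspanZ; apply: inspan_monom => j.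
by apply: leq_trans DD; apply: leq_add; rewrite -ltnS.
Qed.

Lemma inspan_pdeg (p : pexpr J) D : (pdeg p <= D)%N -> inspan D (peval p).
Proof.
elim: p D => [c|j|p IHp q IHq|p IHp q IHq] D /= pD.
- apply: (@inspan_ext _ (fun x => c * monom (fun=> 0%N) x)).
    by move=> x; rewrite /monom big1 ?mulr1 // => j _; rewrite expr0.
  by apply: inspanZ; apply: inspan_monom.
- apply: (@inspan_ext _ (monom (fun k => k == j))).
    move=> x; rewrite /monom (bigD1 j) //= eqxx expr1 big1 ?mulr1 //.
    by move=> k /negbTE ->; rewrite expr0.
  by apply: inspan_monom => k; apply: leq_trans pD; apply: leq_b1.
- by move: pD; rewrite geq_max => /andP[? ?]; apply: inspanD; [apply: IHp|apply: IHq].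
- by apply: (inspanM pD); [apply: IHp|apply: IHq].
Qed.

End MonomialSpan.

Definition lincomb (I : Type) (c : nat -> C) (l : seq (pexpr I)) (x : I -> C) : C :=
  \sum_(k < size l) c k * peval (nth (PConst 0) l k) x.

Definition lfree (I : Type) (Z : aset I) (l : seq (pexpr I)) :=
  forall c, (forall x, Z x -> lincomb c l x = 0) ->
  forall k, (k < size l)%N -> c k = 0.

Lemma polyfun_lincomb (I : Type) c (l : seq (pexpr I)) : polyfun (lincomb c l).
Proof.
apply: polyfun_sum => k _; apply: polyfunM; first exact: polyfun_const.
exact: polyfun_peval.
Qed.

(** More polynomials than monomials give a coefficient matrix with a nonzero left kernel, hence a
    nontrivial relation. *)
Lemma lfree_size_le (J : finType) (l : seq (pexpr J)) D :
  (forall k, (k < size l)%N -> (pdeg (nth (PConst 0%R) l k) <= D)%N) ->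
  lfree (fun _ : J -> C => True) l -> (size l <= D.+1 ^ #|J|)%N.
Proof.
move=> dl fl; rewrite leqNgt; apply/negP => lt.
have [M HM] : exists M : 'I_(size l) -> {ffun J -> 'I_D.+1} -> C, forall (k : 'I_(size l)) x,
    peval (nth (PConst 0) l k) x = \sum_e M k e * monom (fun j => e j) x.
  have H (k : 'I_(size l)) := inspan_pdeg (dl k (ltn_ord k)).
  by have [M HM] := fin_all_exists H; exists M.
pose A : 'M[C]_(size l, #|{ffun J -> 'I_D.+1}|) := \matrix_(k, e) M k (enum_val e).
have kn0 : kermx A != 0.
  rewrite kermx_eq0 /row_free neq_ltn; apply/orP; left.
  by rewrite (leq_ltn_trans (rank_leq_col A)) // card_ffun card_ord.
have /rowV0Pn [v /sub_kermxP vA vn0] := kn0.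
case/negP: vn0; apply/eqP/rowP => k; rewrite mxE.
pose c n := if insub n is Some i then v 0 i else 0.
have ck i : c (nat_of_ord i) = v 0 i by rewrite /c valK.
rewrite -ck; apply: fl => // x _.
rewrite /lincomb; under eq_bigr => i _ do rewrite HM ck mulr_sumr.
rewrite exchange_big big1 //= => e _.
under eq_bigr => i _ do rewrite mulrA.
rewrite -mulr_suml; have /rowP/(_ (enum_rank e)) := vA; rewrite !mxE.
under eq_bigr => i _ do rewrite mxE enum_rankK.
by move->; rewrite mul0r.
Qed.

Lemma lincomb_cat (I : Type) c (l1 l2 : seq (pexpr I)) x :
  lincomb c (l1 ++ l2) x = lincomb c l1 x + lincomb (fun k => c (size l1 + k)%N) l2 x.
Proof.
rewrite /lincomb size_cat big_split_ord /=; congr (_ + _); apply: eq_bigr => k _.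
  by rewrite nth_cat ltn_ord.
by rewrite nth_cat ltnNge leq_addr /= addKn.
Qed.

Lemma lincomb_mul (I : Type) c f (l : seq (pexpr I)) x :
  lincomb c (map (PMul f) l) x = peval f x * lincomb c l x.
Proof.
rewrite /lincomb size_map mulr_sumr; apply: eq_bigr => k _.
by rewrite (nth_map (PConst 0)) //= mulrCA.
Qed.

(* If f vanishes on Z but not on the irreducible Z', setting f = 0 kills the second
   block, and f can be cancelled afterwards. *)
Lemma lfree_cat_mul (I : Type) (Z Z' : aset I) f l l' :
  asubset Z Z' -> zirreducible Z' ->
  (forall x, Z x -> peval f x = 0) -> ~ (forall x, Z' x -> peval f x = 0) ->
  lfree Z l -> lfree Z' l' -> lfree Z' (l ++ map (PMul f) l').
Proof.
move=> ZZ' irr fZ fZ' Fl Fl' c c0.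
have cl k : (k < size l)%N -> c k = 0.
  apply: Fl => x Zx; have := c0 x (ZZ' x Zx).
  by rewrite lincomb_cat lincomb_mul fZ // mul0r addr0.
have cl' k : (k < size l')%N -> c (size l + k)%N = 0.
  apply: (Fl' (fun k => c (size l + k)%N)) => {}k.
  have [p Hp] := polyfun_lincomb (fun k => c (size l + k)%N) l'.
  case: (@zirreducible_prime _ Z' f p irr) => [x Zx|//|H]; last by rewrite -Hp; apply: H.
  have := c0 x Zx; rewrite lincomb_cat lincomb_mul Hp.
  rewrite [X in X + _]/lincomb big1 ?add0r // => i _; rewrite cl ?mul0r //.
move=> k; rewrite size_cat size_map; case: (ltnP k (size l)) => [/cl //|lk kl].
by rewrite -(subnKC lk) cl' // ltn_subLR.
Qed.

Definition pdeg_le (I : Type) (D : nat) (l : seq (pexpr I)) :=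
  forall k, (pdeg (nth (PConst 0%R) l k) <= D)%N.

(** The witness consists of the products of [l] with the first [s] powers of [f], built by iterating
    [lfree_cat_mul]. *)
Lemma lfree_powers (I : Type) (Z Z' : aset I) f l D s :
  asubset Z Z' -> zirreducible Z' ->
  (forall x, Z x -> peval f x = 0) -> ~ (forall x, Z' x -> peval f x = 0) ->
  lfree Z l -> pdeg_le D l ->
  exists l', [/\ lfree Z' l', size l' = (s * size l)%N & pdeg_le (D + s * pdeg f) l'].
Proof.
move=> ZZ' irr fZ fZ' Fl dl; elim: s => [|s [l' [Fl' sl' dl']]].
  by exists [::]; split=> // k; rewrite nth_nil.
exists (l ++ map (PMul f) l'); split.
- exact: lfree_cat_mul Fl Fl'.
- by rewrite size_cat size_map sl' mulSn.
- move=> k; rewrite nth_cat; case: ltnP => kl.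
    by rewrite (leq_trans (dl k)) ?leq_addr.
  case: (ltnP (k - size l) (size l')) => kl'; last by rewrite nth_default ?size_map.
  rewrite (nth_map (PConst 0)) //= mulSn addnCA leq_add2l.
  exact: dl'.
Qed.

(** Each strict inclusion supplies a polynomial [f] vanishing on the smaller set but not on the
    larger. Its first [s] powers multiply the number of independent functions by [s] and raise the
    degree by at most [s * pdeg f]. This bounds the growth of the Hilbert function from below. *)
Lemma irr_chain_lfree (I : Type) (Z : nat -> aset I) n :
  (forall k, (k <= n)%N -> zirreducible (Z k)) ->
  (forall k, (k < n)%N -> aproper (Z k) (Z k.+1)) ->
  exists a, forall s, exists l,
    [/\ lfree (Z n) l, size l = (s ^ n)%N & pdeg_le (s * a) l].
Proof.
elim: n => [|n IH] irr prop.
  exists 0%N => s; exists [:: PConst 1]; split=> //.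
  - move=> c c0 [|//] _; case: (irr 0%N isT) => _ [[x Zx] _].
    by have := c0 x Zx; rewrite /lincomb big_ord_recl big_ord0 addr0 /= mulr1.
  - by case=> [|k] //=; rewrite nth_nil.
have [||a Ha] := IH; [by move=> k kn; apply: irr; apply: leqW| by
  move=> k kn; apply: prop; apply: leqW|].
have [ZZ' /asubset_nP [x [Zx nZx]]] := prop n (ltnSn n).
have [cZ _] := irr n (leqnSn n).
have [f [fZ fx]] := zclosed_sep cZ nZx.
exists (a + pdeg f)%N => s; have [l [Fl sl dl]] := Ha s.
have fZ' : ~ (forall x, Z n.+1 x -> peval f x = 0) by move/(_ x Zx).
have [l' [Fl' sl' dl']] := lfree_powers s ZZ' (irr n.+1 (leqnn _)) fZ fZ' Fl dl.
by exists l'; rewrite sl' sl expnS mulnDr.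
Qed.

(** Pulled back along [phi], the [s ^ n] polynomials remain independent and have degree at most
    [s * a * b]. Counting monomials gives [s ^ n <= (s * a * b).+1 ^ #|J|], which fails for large
    [s] if [n > #|J|]. *)
Lemma irr_chain_le_card (J I : finType) (phi : (J -> C) -> I -> C) n :
  polymap phi -> irr_chain (zclosure (prange phi)) n -> (n <= #|J|)%N.
Proof.
move=> pphi [Z [irrZ propZ]].
have irr k : (k <= n)%N -> zirreducible (Z k) by move/irrZ => [].
have [_ Zsub] := irrZ n (leqnn n).
have [a Ha] := irr_chain_lfree irr propZ.
have [P HP] := @fin_all_exists _ (fun=> pexpr J)
  (fun i p => forall t, peval p t = phi t i) pphi.
pose b := \max_i pdeg (P i).
have Pb i : (pdeg (P i) <= b)%N by apply: leq_bigmax.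
(* Since [s] exceeds [(a * b).+1 ^ k], the bound [s ^ k * (a * b).+1 ^ k] is below [s ^ k.+1]. *)
pose k := #|J|; pose s := ((a * b).+1 ^ k).+1.
have [l [Fl sl dl]] := Ha s.
rewrite leqNgt; apply/negP => kn.
have Pphi t : (fun i => peval (P i) t) = phi t.
  by apply: functional_extensionality => i; rewrite HP.
have : (size (map (psubst P) l) <= (s * a * b).+1 ^ k)%N.
  apply: lfree_size_le => [i|c c0 i].
    rewrite size_map => il; rewrite (nth_map (PConst 0)) //.
    by rewrite (leq_trans (pdeg_psubst _ Pb)) // leq_mul2r dl orbT.
  rewrite size_map; apply: Fl => x /Zsub cx.
  apply: zclosure_poly0 (polyfun_lincomb c l) _ _ cx => _ [t <-].
  rewrite -(c0 t Logic.I) /lincomb size_map; apply: eq_bigr => j _.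
  by rewrite (nth_map (PConst 0)) // peval_psubst Pphi.
rewrite size_map sl; apply/negP; rewrite -ltnNge.
have le1 : ((s * a * b).+1 <= s * (a * b).+1)%N.
  by rewrite mulnS -mulnA -add1n leq_add2r.
have le2 : ((s * a * b).+1 ^ k <= s ^ k * (a * b).+1 ^ k)%N.
  by rewrite -expnMn; case: (k) => // k'; rewrite leq_exp2r.
apply: (leq_ltn_trans le2); apply: (@leq_trans (s ^ k.+1)).
  by rewrite expnSr ltn_pmul2l ?expn_gt0 // ltnSn.
by rewrite leq_pexp2l.
Qed.

(** * Lower bound for the dimension and finite unions *)

Section LowerBound.
Variables (J I : finType) (phi : (J -> C) -> I -> C) (t0 : J -> C).
Hypothesis pphi : polymap phi.
Hypothesis left_inv : forall j, exists q g : (I -> C) -> C,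
  [/\ polyfun q, polyfun g, forall t, q (phi t) = t j * g (phi t) & g (phi t0) != 0].

(** The first [k] coordinates are free and the others frozen at the base point; the closures of the
    images of these slices form the chain. *)
Let slice (k : nat) (t : J -> C) (j : J) := if (enum_rank j < k)%N then t j else t0 j.

Let polymap_slice k : polymap (slice k).
Proof.
by move=> j; rewrite /slice; case: (enum_rank j < k)%N; [apply: polyfun_var|apply: polyfun_const].
Qed.

Let Zs k := zclosure (prange (fun t => phi (slice k t))).

Let Zs_sub k : asubset (Zs k) (zclosure (prange phi)).
Proof. by apply: zclosureS => _ [t <-]; exists (slice k t). Qed.

Let Zs_subS k : asubset (Zs k) (Zs k.+1).
Proof.
apply: zclosureS => _ [t <-]; exists (slice k t); congr phi.
apply: functional_extensionality => j; rewrite /slice.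
by case: (ltnP _ k) => jk; [rewrite ltnS ltnW | case: ifP].
Qed.

(** For the coordinate [j] of rank [k], the function [q - t0 j * g] vanishes on [Zs k]. If it
    vanished on [Zs k.+1] too, then on the line through [t0] in direction [j] the line parameter
    times [g] would vanish, hence [g] itself, against [g (phi t0) != 0]. *)
Let Zs_proper k : (k < #|J|)%N -> ~ asubset (Zs k.+1) (Zs k).
Proof.
move=> kJ sub; pose j := enum_val (Ordinal kJ).
have jk : enum_rank j = k :> nat by rewrite /j enum_valK.
have [q [g [pq pg qg g0]]] := left_inv j.
have pF : polyfun (fun x => q x - t0 j * g x).
  exact: polyfunB pq (polyfunM (polyfun_const _ _) pg).
have F0 x : Zs k.+1 x -> q x - t0 j * g x = 0.
  move=> /sub; apply: zclosure_poly0 pF _ x => _ [t <-].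
  by rewrite qg /slice jk ltnn subrr.
pose line (i : J) : {poly C} := (t0 i)%:P + (if i == j then 'X else 0).
have lineE t i : (line i).[t] = t0 i + (if i == j then t else 0).
  by rewrite /line hornerD hornerC; case: eqP => _; rewrite ?hornerX ?horner0.
have [P HP] := polyfun_curve line (polyfun_comp pphi pg).
have XP0 : 'X * P = 0.
  apply: horner_eq0_all => t; rewrite hornerM hornerX HP.
  set u := fun i => (line i).[t].
  have uE : slice k.+1 u = u.
    apply: functional_extensionality => i; rewrite /slice /u lineE.
    case: eqP => [->|]; first by rewrite jk leqnn.
    by rewrite addr0; case: ifP.
  have := F0 (phi u); rewrite qg /u lineE eqxx -mulrBl addrC addKr; apply.
  by apply: sub_zclosure; exists u; rewrite uE.
have P0 : P = 0 by apply/eqP; move/eqP: XP0; rewrite mulf_eq0 polyX_eq0.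
case/negP: g0; have := HP 0; rewrite P0 horner0 => /esym/eqP.
congr (g (phi _) == 0); apply: functional_extensionality => i.
by rewrite lineE if_same addr0.
Qed.

Lemma irr_chain_card : irr_chain (zclosure (prange phi)) #|J|.
Proof.
exists Zs; split=> k kJ; last by split; [apply: Zs_subS|apply: Zs_proper].
split; last exact: Zs_sub.
apply: zirreducible_zclosure_prange => i.
exact: polyfun_comp (polymap_slice k) (pphi i).
Qed.

Lemma zdim_zclosure_prange : zdim (zclosure (prange phi)) #|J|.
Proof.
by split; [apply: irr_chain_card|move/(irr_chain_le_card pphi); rewrite ltnn].
Qed.

End LowerBound.

Lemma irr_chain_sub (I : Type) (X : aset I) n (Z : nat -> aset I) :
  (forall k, (k <= n)%N -> zirreducible (Z k)) ->
  (forall k, (k < n)%N -> aproper (Z k) (Z k.+1)) -> asubset (Z n) X ->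
  irr_chain X n.
Proof.
move=> irr prop ZX; exists Z; split=> // k kn; split; first exact: irr.
suff H j : (j <= n)%N -> asubset (Z (n - j)%N) X.
  by rewrite -(subKn kn); apply: H; apply: leq_subr.
elim: j => [_|j IH jn]; first by rewrite subn0.
move=> x Zx; apply: (IH (ltnW jn)).
have /prop [sub _] : (n - j.+1 < n)%N by rewrite ltn_subLR // addSn ltnS leq_addl.
by have := sub x Zx; rewrite subnSK.
Qed.

Lemma irr_chain_le (I : Type) (X : aset I) m n :
  (m <= n)%N -> irr_chain X n -> irr_chain X m.
Proof.
move=> mn [Z [Z1 Z2]]; exists Z; split=> k km; first by apply: Z1; apply: leq_trans mn.
by apply: Z2; apply: leq_trans mn.
Qed.

Lemma irr_chainS (I : Type) (X Y : aset I) n :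
  asubset X Y -> irr_chain X n -> irr_chain Y n.
Proof.
by move=> XY [Z [Z1 Z2]]; exists Z; split=> // k /Z1 [? ZX]; split=> // x /ZX /XY.
Qed.

Lemma irr_chain_leq_zdim (I : Type) (X : aset I) m n :
  zdim X n -> irr_chain X m -> (m <= n)%N.
Proof.
move=> [_ nX] cX; rewrite leqNgt; apply/negP => nm; exact/nX/(irr_chain_le nm).
Qed.

Lemma zdim_uniq (I : Type) (X : aset I) m n : zdim X m -> zdim X n -> m = n.
Proof.
move=> Xm Xn; apply/eqP; rewrite eqn_leq (irr_chain_leq_zdim Xn (proj1 Xm)).
by rewrite (irr_chain_leq_zdim Xm (proj1 Xn)).
Qed.

Lemma aset_eq (I : Type) (A B : aset I) : asubset A B -> asubset B A -> A = B.
Proof.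
move=> AB BA; apply: functional_extensionality => x.
by apply: propositional_extensionality; split; [apply: AB|apply: BA].
Qed.

Section FiniteUnion.
Variables (I : Type) (T : eqType) (L : seq T) (V : T -> aset I) (D : T -> nat).
Variables (X : aset I) (n : nat).
Hypothesis irrV : forall r, r \in L -> zirreducible (V r).
Hypothesis dimV : forall r, r \in L -> zdim (V r) (D r).
Hypothesis VX : forall x, X x <-> exists2 r, r \in L & V r x.
Hypothesis Dn : forall r, r \in L -> (D r <= n)%N.

Let sub_one (Z : aset I) : zirreducible Z -> asubset Z X ->
  exists2 r, r \in L & asubset Z (V r).
Proof.
move=> irrZ ZX.
(* The empty set, cut out by the constant 1, replaces [V r] outside [L], so that every member of the
   family is closed. *)
pose V' r := if r \in L then V r else (fun=> False).
have [||r rL ZV] := @zirreducible_bigcup _ _ L V' Z irrZ.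
- move=> r; rewrite /V'; case: ifP => rL; first by case: (irrV rL).
  exists (fun p => p = PConst 1) => x; split=> // /(_ _ erefl) /eqP /=.
  by rewrite oner_eq0.
- by move=> x /ZX /VX [r rL Vx]; exists r; rewrite // /V' rL.
by exists r => // x /ZV; rewrite /V' rL.
Qed.

Let VsubX r : r \in L -> asubset (V r) X.
Proof. by move=> rL x Vx; apply/VX; exists r. Qed.

Lemma zdim_finite_union r0 : r0 \in L -> D r0 = n -> zdim X n.
Proof.
move=> r0L D0; split.
  by rewrite -D0; apply: irr_chainS (VsubX r0L) (proj1 (dimV r0L)).
move=> [Z [Z1 Z2]].
have irr k : (k <= n.+1)%N -> zirreducible (Z k) by case/Z1.
have [irrZ ZX] := Z1 n.+1 (leqnn _).
have [r rL ZV] := sub_one irrZ ZX.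
have := irr_chain_leq_zdim (dimV rL) (irr_chain_sub irr Z2 ZV).
by rewrite leqNgt ltnS Dn.
Qed.

(** A component lies in some [V r] and equals it by maximality. Conversely, an irreducible set
    strictly larger than a [V r] of dimension [n] would extend a chain of length [n] in [X]. *)
Lemma top_component_finite_union Z : zdim X n ->
  (irr_component X Z /\ zdim Z n) <-> exists2 r, r \in L & D r = n /\ V r = Z.
Proof.
move=> dimX; split.
- case=> -[irrZ [ZX maxZ]] dimZ; have [r rL ZV] := sub_one irrZ ZX.
  have VZ : V r = Z.
    by apply: aset_eq => //; apply: maxZ => //; [apply: irrV|apply: VsubX].
  by exists r => //; split=> //; apply: zdim_uniq dimZ; rewrite -VZ; apply: dimV.
- case=> r rL [Dr <-]; split; last by rewrite -Dr; apply: dimV.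
  split; first exact: irrV; split; first exact: VsubX.
  move=> Z' irrZ' Z'X VZ' x Z'x; apply: NNPP => nVx.
  have [[W [W1 W2]] _] := dimV rL.
  have [_ WV] := W1 _ (leqnn _).
  pose W' k := if (k <= n)%N then W k else Z'.
  have : irr_chain X n.+1.
    exists W'; split=> k kn; rewrite /W'.
    + case: leqP => kn'; last by split.
      by rewrite -Dr in kn'; have [? WVk] := W1 k kn'; split=> // y /WVk; apply: VsubX.
    + rewrite -ltnS kn; case: (ltnP k n) => kn'; first by apply: W2; rewrite Dr.
      have kn'' : k = n by apply/eqP; rewrite eqn_leq kn' andbT -ltnS.
      rewrite kn'' -Dr; split=> [y /WV /VZ' //|sub]; exact/nVx/WV/sub.
  by case: dimX.
Qed.

End FiniteUnion.

(** * Shears and ranks *)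

Section MatrixLemmas.
Variable F : fieldType.

Lemma mul_pid_mxE m n r (A : 'M[F]_(m, n)) k l :
  (pid_mx r *m A) k l = if (k < r)%N then A k l else 0.
Proof.
rewrite mxE (bigD1 k) //= big1 ?addr0 => [|j /negbTE jk].
  by rewrite mxE eqxx /=; case: ifP => _; rewrite ?mul1r ?mul0r.
by rewrite mxE eq_sym val_eqE jk mul0r.
Qed.

Lemma mulmx_pidE m n r (A : 'M[F]_(m, n)) k l :
  (A *m pid_mx r) k l = if (l < r)%N then A k l else 0.
Proof.
rewrite mxE (bigD1 l) //= big1 ?addr0 => [|j /negbTE jk].
  by rewrite mxE eqxx /=; case: ifP => _; rewrite ?mulr1 ?mulr0.
by rewrite mxE val_eqE jk mulr0.
Qed.

(** The columns of [H] lie in the span of the first [r] basis vectors and fill it by the rank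
    condition, so [T] kills that span. In row form: the left kernel of [H] is the row space of
    [copid_mx r]. *)
Lemma mulmx_pid_eq0 m n p r (H : 'M[F]_(m, n)) (T : 'M[F]_(p, m)) :
  (r <= m)%N -> pid_mx r *m H = H -> \rank H = r -> T *m H = 0 ->
  T *m (pid_mx r : 'M_m) = 0.
Proof.
move=> rm EH rH TH.
have cH : (copid_mx r <= kermx H)%MS.
  by apply/sub_kermxP; rewrite /copid_mx mulmxBl mul1mx EH subrr.
have /mxrank_leqif_eq [_] := cH.
rewrite mxrank_ker rank_copid_mx // rH eqxx => /esym/andP[_ kc].
have /submxP [D ->] : (T <= copid_mx r)%MS.
  by apply: submx_trans kc; apply/sub_kermxP.
by rewrite -mulmxA mul_copid_mx_pid // mulmx0.
Qed.

(** By the rank hypothesis the first [r] rows of [M] span its row space, so the other rows are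
    combinations of them. *)
Lemma exists_shear_lower m n r (M : 'M[F]_(m, n)) :
  (r <= m)%N -> \rank ((pid_mx r : 'M_m) *m M) = \rank M ->
  exists X : 'M[F]_m, [/\ (pid_mx r : 'M_m) *m X = 0, X *m pid_mx r = X
                        & copid_mx r *m M = X *m M].
Proof.
move=> rm rk; have /mxrank_leqif_eq [_] := submxMl (pid_mx r : 'M_m) M.
rewrite rk eqxx => /esym/andP[_ /submxP [D MD]].
exists (copid_mx r *m D *m pid_mx r); split.
- by rewrite !mulmxA mul_pid_mx_copid // !mul0mx.
- by rewrite -[LHS]mulmxA pid_mx_id.
- by rewrite -!mulmxA -MD.
Qed.

(** The matrix [X *m Q] maps the left kernel of [P] injectively into [Q :\: P], which meets the row
    space of [P] only in zero; the rank hypothesis makes [Q :\: P] large enough. *)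
Lemma exists_row_free_add k p n (P : 'M[F]_(k, n)) (Q : 'M[F]_(p, n)) :
  (k <= \rank (P + Q)%MS)%N -> exists X : 'M[F]_(k, p), row_free (P + X *m Q).
Proof.
move=> kPQ; pose B := row_base (Q :\: P)%MS; pose K := row_base (kermx P).
have Kfree : row_free K by apply: row_base_free.
have Bfree : row_free B by apply: row_base_free.
have rkB : (\rank (kermx P) <= \rank (Q :\: P)%MS)%N.
  rewrite mxrank_ker leq_subLR (leq_trans kPQ) //.
  have <- : (P + (Q :\: P) :=: P + Q)%MS.
    apply/eqmxP/andP; split; first by rewrite addsmxS ?diffmxSl.
    rewrite addsmx_sub addsmxSl /= -(addsmx_diff_cap_eq Q P).
    by rewrite addsmx_sub addsmxSr /= (submx_trans (capmxSr _ _)) ?addsmxSl.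
  exact: mxrank_adds_leqif.
have /submxP [D BD] : (B <= Q)%MS by rewrite eq_row_base diffmxSl.
exists (pinvmx K *m pid_mx (\rank (kermx P)) *m D).
rewrite -mulmxA -BD; apply: inj_row_free => v.
rewrite mulmxDr => /eqP; rewrite addr_eq0 => /eqP vP.
have vP0 : v *m P = 0.
  apply/eqP; rewrite -submx0 -(capmx_diff Q P) sub_capmx submxMl andbT vP.
  by rewrite -mulNmx mulmxA (submx_trans (submxMl _ _)) // eq_row_base.
have /submxP [w vK] : (v <= K)%MS by rewrite eq_row_base; apply/sub_kermxP.
move/eqP: vP; rewrite vP0 eq_sym oppr_eq0 mulmxA mulmx_free_eq0 //.
rewrite vK mulmxA mulmxKp // => /eqP w0.
have /eqP : w *m (pid_mx (\rank (kermx P)) : 'M_(_, \rank (Q :\: P)%MS)) = 0 by [].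
rewrite mulmx_free_eq0; first by move/eqP->; rewrite mul0mx.
by rewrite /row_free rank_pid_mx.
Qed.

(** Adding combinations of the lower rows makes the first [\rank M] rows independent:
    [exists_row_free_add] is applied with [P] the upper and [Q] the lower rows. *)
Lemma exists_shear_upper m n (M : 'M[F]_(m, n)) (E := pid_mx (\rank M) : 'M[F]_m) :
  exists X : 'M[F]_m,
    [/\ E *m X = X, X *m E = 0 & \rank (E *m M + X *m M)%R = \rank M].
Proof.
rewrite {}/E; set r := \rank M; have rm : (r <= m)%N by apply: rank_leq_row.
pose Jr : 'M[F]_(r, m) := pid_mx r; pose Jl : 'M[F]_(m, r) := pid_mx r.
have JlJr : Jl *m Jr = pid_mx r by rewrite mul_pid_mx !minnn.
have JrJl : Jr *m Jl = 1%:M by rewrite mul_pid_mx minnn (minn_idPr rm) pid_mx_1.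
have [|X0 freeX] := @exists_row_free_add _ _ _ (Jr *m M) (copid_mx r *m M).
  apply: mxrankS; rewrite -{1}(mul1mx M) -(subrK (pid_mx r) 1%:M) mulmxDl addrC.
  by apply: addmx_sub_adds; rewrite // -JlJr -mulmxA submxMl.
exists (Jl *m X0 *m copid_mx r); split.
- by rewrite !mulmxA pid_mx_id.
- by rewrite -mulmxA mul_copid_mx_pid // mulmx0.
have -> : pid_mx r *m M + Jl *m X0 *m copid_mx r *m M
    = Jl *m (Jr *m M + X0 *m (copid_mx r *m M)).
  by rewrite mulmxDr !mulmxA JlJr.
apply/eqP; rewrite eqn_leq (leq_trans (mxrankM_maxl _ _)) ?rank_leq_col //=.
rewrite -{1}(eqP freeX) -{1}[_ + _]mul1mx -JrJl -mulmxA; exact: mxrankM_maxr.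
Qed.

(** Together with [rank_lt_det0], this turns a lower bound on the rank into the non-vanishing of one
    determinant, polynomial in the matrix. *)
Lemma exists_unit_sandwich m n (A : 'M[F]_(m, n)) :
  exists (L : 'M[F]_(\rank A, m)) (R : 'M[F]_(n, \rank A)), L *m A *m R = 1%:M.
Proof.
exists (pinvmx (col_base A)), (pinvmx (row_base A)).
rewrite -[X in _ *m X *m _]mulmx_base mulmxA mulVpmx ?col_base_full // mul1mx.
by rewrite mulmxVp ?row_base_free.
Qed.

Lemma rank_lt_det0 m n k (A : 'M[F]_(m, n)) (L : 'M[F]_(k, m)) (R : 'M[F]_(n, k)) :
  (\rank A < k)%N -> \det (L *m A *m R) = 0.
Proof.
move=> lt; apply/eqP; apply: contraLR lt => nz; rewrite -leqNgt.
have : row_free (L *m A *m R) by rewrite row_free_unit unitmxE unitfE.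
move/eqP => {1}<-; rewrite (leq_trans (mxrankM_maxl _ _)) //; exact: mxrankM_maxr.
Qed.

Lemma mulmx_shear_inv n (X : 'M[F]_n) : X *m X = 0 ->
  (1%:M + X) *m (1%:M - X) = 1%:M /\ (1%:M - X) *m (1%:M + X) = 1%:M.
Proof.
move=> X0; rewrite !mulmxDl !mulmxDr !mulmxN !mulNmx !mul1mx !mulmx1 X0.
by rewrite oppr0 !addr0 subrK addrK.
Qed.

End MatrixLemmas.

(** * Polynomial matrix functions and coordinates of the representation space *)

Definition mxpolyfun (I : Type) m n (F : (I -> C) -> 'M[C]_(m, n)) :=
  forall k l, polyfun (fun x => F x k l).

Lemma mxpolyfun_const (I : Type) m n (A : 'M[C]_(m, n)) :
  mxpolyfun (fun _ : I -> C => A).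
Proof. by move=> k l; apply: polyfun_const. Qed.

Lemma mxpolyfunD (I : Type) m n (F G : (I -> C) -> 'M[C]_(m, n)) :
  mxpolyfun F -> mxpolyfun G -> mxpolyfun (fun x => F x + G x).
Proof.
by move=> pF pG k l; apply: polyfun_ext (polyfunD (pF k l) (pG k l)) => x; rewrite mxE.
Qed.

Lemma mxpolyfunB (I : Type) m n (F G : (I -> C) -> 'M[C]_(m, n)) :
  mxpolyfun F -> mxpolyfun G -> mxpolyfun (fun x => F x - G x).
Proof.
by move=> pF pG k l; apply: polyfun_ext (polyfunB (pF k l) (pG k l)) => x; rewrite !mxE.
Qed.

Lemma mxpolyfunZ (I : Type) m n f (F : (I -> C) -> 'M[C]_(m, n)) :
  polyfun f -> mxpolyfun F -> mxpolyfun (fun x => f x *: F x).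
Proof.
by move=> pf pF k l; apply: polyfun_ext (polyfunM pf (pF k l)) => x; rewrite mxE.
Qed.

Lemma mxpolyfunM (I : Type) m n p (F : (I -> C) -> 'M[C]_(m, n))
    (G : (I -> C) -> 'M[C]_(n, p)) :
  mxpolyfun F -> mxpolyfun G -> mxpolyfun (fun x => F x *m G x).
Proof.
move=> pF pG k l; apply: (@polyfun_ext _ (fun x => \sum_j F x k j * G x j l)).
  by move=> x; rewrite mxE.
by apply: polyfun_sum => j _; apply: polyfunM.
Qed.

Lemma polyfun_det (I : Type) n (F : (I -> C) -> 'M[C]_n) :
  mxpolyfun F -> polyfun (fun x => \det (F x)).
Proof.
move=> pF; apply: polyfun_sum => s _; apply: polyfunM; first exact: polyfun_const.
by apply: polyfun_prod => i _; apply: pF.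
Qed.

Lemma mxpolyfun_adj (I : Type) n (F : (I -> C) -> 'M[C]_n) :
  mxpolyfun F -> mxpolyfun (fun x => \adj (F x)).
Proof.
move=> pF k l; apply: (@polyfun_ext _ (fun x => cofactor (F x) l k)).
  by move=> x; rewrite mxE.
apply: polyfunM; first exact: polyfun_const.
apply: polyfun_det => i j; apply: polyfun_ext (pF (lift l i) (lift k j)) => x.
by rewrite !mxE.
Qed.

Definition mkrep (N : nat) (d : nat -> nat) (A : forall i, 'M[C]_(d i.+1, d i)) :
  rep_coord N d -> C := fun c => A (tag c) (tagged c).1 (tagged c).2.

Lemma rep_entryE N d (x : rep_coord N d -> C) (c : rep_coord N d) :
  rep_entry x (tag c) (tagged c).1 (tagged c).2 = x c.
Proof.
rewrite /rep_entry; case: pickP => [c' /and3P[/eqP e1 /eqP e2 /eqP e3]|/(_ c)].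
  congr x; case: c' c e1 e2 e3 => i' [k' l'] [i [k l]] /= /val_inj e1.
  by subst i' => /val_inj -> /val_inj ->.
by rewrite !eqxx.
Qed.

Lemma rep_mx_mkrep N d (A : forall i, 'M[C]_(d i.+1, d i)) i :
  (i < N)%N -> rep_mx (mkrep (N := N) A) i = A i.
Proof.
move=> iN; apply/matrixP => k l; rewrite mxE.
pose c : rep_coord N d := @Tagged 'I_N (Ordinal iN)
  (fun i => ('I_(d i.+1) * 'I_(d i))%type) (k, l).
exact: (rep_entryE (mkrep A) c).
Qed.

Lemma mkrep_rep_mx N d (x : rep_coord N d -> C) : mkrep (rep_mx x) = x.
Proof.
by apply: functional_extensionality => c; rewrite /mkrep mxE rep_entryE.
Qed.

Lemma eq_mkrep N d (A B : forall i, 'M[C]_(d i.+1, d i)) :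
  (forall i, (i < N)%N -> A i = B i) -> mkrep (N := N) A = mkrep B.
Proof.
by move=> AB; apply: functional_extensionality => c; rewrite /mkrep AB.
Qed.

Lemma polymap_mkrep (I : Type) N d (A : (I -> C) -> forall i, 'M[C]_(d i.+1, d i)) :
  (forall i, (i < N)%N -> mxpolyfun (fun y => A y i)) ->
  polymap (fun y => mkrep (N := N) (A y)).
Proof. by move=> pA c; apply: pA. Qed.

Lemma mxpolyfun_rep_mx N d i : mxpolyfun (fun x : rep_coord N d -> C => rep_mx x i).
Proof.
move=> k l; apply: (@polyfun_ext _ (fun x => rep_entry x i k l)).
  by move=> x; rewrite mxE.
rewrite /rep_entry; case: [pick c | _] => [c|]; first exact: polyfun_var.
exact: polyfun_const.
Qed.

Lemma mxpolyfun_rep_prod N d i : mxpolyfun (fun x : rep_coord N d -> C => rep_prod x i).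
Proof.
elim: i => [|i IH] /=; first exact: mxpolyfun_const.
by apply: mxpolyfunM => //; apply: mxpolyfun_rep_mx.
Qed.

(** * Charts of the rank strata *)

Section Stratum.
Variables (N : nat) (d r : nat -> nat).

Notation E v := (pid_mx (r v) : 'M[C]_(d v)).

Definition admissible (X : forall v, 'M[C]_(d v)) (T : forall v, 'M[C]_(d v.+1, d v)) :=
  (forall v, (v <= N)%N -> E v *m X v = 0 /\ X v *m E v = X v) /\
  (forall v, (v < N)%N -> E v.+1 *m T v *m E v = T v *m E v).

Definition chart (X : forall v, 'M[C]_(d v)) (T : forall v, 'M[C]_(d v.+1, d v)) :
  rep_coord N d -> C :=
  mkrep (fun v => (1%:M + X v.+1) *m T v *m (1%:M - X v)).

(** A common bound for the step index and all row and column indices, so that all parameters live in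
    one finite type. *)
Definition chart_bound := (N + \sum_(i < N.+1) d i)%N.
Notation B := chart_bound.

(** The entries that [admissible] does not force to vanish: [true] selects those of [X v], [false]
    those of [T v]. *)
Definition chart_mask (b : bool) (v k l : nat) :=
  if b then [&& v <= N, r v <= k, k < d v & l < r v]%N
  else [&& v < N, k < d v.+1, l < d v & ~~ ((r v.+1 <= k) && (l < r v))]%N.

Definition chart_coord : finType :=
  {c : bool * ('I_B.+1 * ('I_B.+1 * 'I_B.+1)) |
    chart_mask c.1 c.2.1 c.2.2.1 c.2.2.2}.

Definition chart_entry (t : chart_coord -> C) (b : bool) (v k l : nat) : C :=
  oapp t 0 (insub (b, (inord v, (inord k, inord l)))).

Definition chartX (t : chart_coord -> C) v : 'M[C]_(d v) :=
  \matrix_(k, l) chart_entry t true v k l.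
Definition chartT (t : chart_coord -> C) v : 'M[C]_(d v.+1, d v) :=
  \matrix_(k, l) chart_entry t false v k l.

Definition chart_map (t : chart_coord -> C) : rep_coord N d -> C :=
  chart (chartX t) (chartT t).

Lemma leq_dB v : (v <= N)%N -> (d v <= B)%N.
Proof.
move=> vN; rewrite /B (bigD1 (Ordinal (vN : (v < N.+1)%N))) //= addnCA.
exact: leq_addr.
Qed.

Lemma leq_NB v : (v <= N)%N -> (v <= B)%N.
Proof. by move=> vN; apply: leq_trans vN (leq_addr _ _). Qed.

Lemma chart_entry_out t b v k l : (v <= B)%N -> (k <= B)%N -> (l <= B)%N ->
  ~~ chart_mask b v k l -> chart_entry t b v k l = 0.
Proof. by move=> vB kB lB nm; rewrite /chart_entry insubN //= !inordK. Qed.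

Lemma chart_entry_in t (j : chart_coord) :
  chart_entry t (val j).1 (val j).2.1 (val j).2.2.1 (val j).2.2.2 = t j.
Proof.
rewrite /chart_entry !inord_val.
suff -> : ((val j).1, ((val j).2.1, ((val j).2.2.1, (val j).2.2.2))) = val j.
  by rewrite valK.
by case: (val j) => [b [v [k l]]].
Qed.

Lemma admissible_chart_map t : admissible (chartX t) (chartT t).
Proof.
split=> v vN.
- have vB := leq_NB vN; have dB := leq_dB vN.
  split; apply/matrixP => k l; rewrite ?mul_pid_mxE ?mulmx_pidE !mxE;
    case: ifP => // lt; have := ltn_ord k; have := ltn_ord l => ? ?;
    rewrite chart_entry_out //; (try lia); rewrite /chart_mask; lia.
- have vB := leq_NB (ltnW vN); have dB := leq_dB (ltnW vN); have dB' := leq_dB vN.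
  apply/matrixP => k l; rewrite !mulmx_pidE mul_pid_mxE !mxE.
  case: ifP => // lr; case: ifP => // kr; have := ltn_ord k; have := ltn_ord l => ? ?.
  by rewrite chart_entry_out //; (try lia); rewrite /chart_mask; lia.
Qed.

Definition mx_entry m n (A : 'M[C]_(m, n)) (k l : nat) : C :=
  if insub k is Some k' then if insub l is Some l' then A k' l' else 0 else 0.

Lemma mx_entryE m n (A : 'M[C]_(m, n)) (k : 'I_m) (l : 'I_n) : mx_entry A k l = A k l.
Proof. by rewrite /mx_entry !valK. Qed.

Definition params_of (X : forall v, 'M[C]_(d v)) (T : forall v, 'M[C]_(d v.+1, d v))
    (j : chart_coord) : C :=
  let: (b, (v, (k, l))) := val j in if b then mx_entry (X v) k l else mx_entry (T v) k l.

Lemma chart_entry_params X T b v k l : (v <= B)%N -> (k <= B)%N -> (l <= B)%N ->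
  chart_entry (params_of X T) b v k l =
  if chart_mask b v k l
  then if b then mx_entry (X v) k l else mx_entry (T v) k l else 0.
Proof.
move=> vB kB lB; case: ifP => m; last by rewrite chart_entry_out ?m.
rewrite /chart_entry insubT /= ?inordK // => m'.
by rewrite /params_of /= !inordK.
Qed.

Lemma params_ofK X T : admissible X T ->
  (forall v, (v <= N)%N -> chartX (params_of X T) v = X v) /\
  (forall v, (v < N)%N -> chartT (params_of X T) v = T v).
Proof.
move=> [aX aT]; split=> v vN.
- have vB := leq_NB vN; have dB := leq_dB vN.
  apply/matrixP => k l; rewrite mxE; have := ltn_ord k; have := ltn_ord l => ? ?.
  rewrite chart_entry_params ?mx_entryE; try lia.
  have [/matrixP/(_ k l) + /matrixP/(_ k l)] := aX v vN.
  rewrite mul_pid_mxE mulmx_pidE !mxE /chart_mask vN ltn_ord /=.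
  by case: (leqP (r v) k) => /= kr; [case: ifP|].
- have vB := leq_NB (ltnW vN); have dB := leq_dB (ltnW vN); have dB' := leq_dB vN.
  apply/matrixP => k l; rewrite mxE; have := ltn_ord k; have := ltn_ord l => ? ?.
  rewrite chart_entry_params ?mx_entryE; try lia.
  have /matrixP/(_ k l) := aT v vN.
  rewrite !mulmx_pidE mul_pid_mxE /chart_mask vN !ltn_ord /=.
  by case: (leqP (r v.+1) k) => //= kr; case: ifP.
Qed.

Lemma prange_chart_map X T : admissible X T -> prange chart_map (chart X T).
Proof.
move=> aXT; exists (params_of X T); have [eX eT] := params_ofK aXT.
by apply: eq_mkrep => v vN; rewrite !eX ?eT // ltnW.
Qed.

Lemma polyfun_chart_entry b v k l : polyfun (fun t => chart_entry t b v k l).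
Proof.
rewrite /chart_entry; case: insub => [j|] /=; first exact: polyfun_var.
exact: polyfun_const.
Qed.

Lemma polymap_chart_map : polymap chart_map.
Proof.
have pX v : mxpolyfun (fun t => chartX t v).
  move=> k l; apply: polyfun_ext (polyfun_chart_entry true v k l) => t.
  by rewrite mxE.
apply: polymap_mkrep => v vN; apply: mxpolyfunM; first apply: mxpolyfunM.
- by apply: mxpolyfunD => //; apply: mxpolyfun_const.
- move=> k l; apply: polyfun_ext (polyfun_chart_entry false v k l) => t.
  by rewrite mxE.
- by apply: mxpolyfunB => //; apply: mxpolyfun_const.
Qed.

Hypothesis r0 : r 0 = d 0.
Hypothesis rS : forall i, (i < N)%N -> (r i.+1 <= r i)%N.
Hypothesis rd : forall i, (i <= N)%N -> (r i <= d i)%N.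

Fixpoint Tprod (T : forall v, 'M[C]_(d v.+1, d v)) i : 'M[C]_(d i, d 0) :=
  match i with 0 => 1%:M | i'.+1 => T i' *m Tprod T i' end.

Section Admissible.
Variables (X : forall v, 'M[C]_(d v)) (T : forall v, 'M[C]_(d v.+1, d v)).
Hypothesis aXT : admissible X T.

Lemma admissible_sqr v : (v <= N)%N -> X v *m X v = 0.
Proof.
move=> /(proj1 aXT) [EX XE]; by rewrite -{1}XE -mulmxA EX mulmx0.
Qed.

Lemma admissible0 : X 0 = 0.
Proof.
by have [+ _] := proj1 aXT 0%N isT; rewrite r0 pid_mx_1 mul1mx.
Qed.

Lemma pid_Tprod i : (i <= N)%N -> E i *m Tprod T i = Tprod T i.
Proof.
elim: i => [_|i IH iN] /=; first by rewrite r0 pid_mx_1 mul1mx.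
by rewrite -{1}(IH (ltnW iN)) !mulmxA (proj2 aXT) // -mulmxA IH ?(ltnW iN).
Qed.

(** Adjacent shears cancel, [(1 - X i) (1 + X i) = 1], because [X i] squares to zero; the shear at 0
    is trivial since [r 0 = d 0]. *)
Lemma rep_prod_chart i : (i <= N)%N ->
  rep_prod (chart X T) i = (1%:M + X i) *m Tprod T i.
Proof.
elim: i => [_|i IH iN] /=; first by rewrite admissible0 addr0 mul1mx.
rewrite IH ?(ltnW iN) // rep_mx_mkrep // -!mulmxA; congr (_ *m _); congr (_ *m _).
by rewrite mulmxA (proj2 (mulmx_shear_inv (admissible_sqr (ltnW iN)))) mul1mx.
Qed.

Lemma rank_rep_prod_chart i : (i <= N)%N -> (\rank (rep_prod (chart X T) i) <= r i)%N.
Proof.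
move=> iN; rewrite rep_prod_chart // -(pid_Tprod iN).
apply: leq_trans (mxrankM_maxr _ _) _; apply: leq_trans (mxrankM_maxl _ _) _.
by rewrite rank_pid_mx ?rd.
Qed.

End Admissible.

(** The upper left block of [A_i ... A_1]; its determinant is the denominator of the rational left
    inverse. *)
Definition topS (x : rep_coord N d -> C) i : 'M[C]_(r i) :=
  (pid_mx (r i) : 'M_(r i, d i)) *m rep_prod x i *m (pid_mx (r i) : 'M_(d 0, r i)).

Definition topdet (x : rep_coord N d -> C) i : C := \det (topS x i).

Definition shear_num (x : rep_coord N d -> C) i : 'M[C]_(d i) :=
  copid_mx (r i) *m rep_prod x i *m (pid_mx (r i) : 'M_(d 0, r i)) *m
  \adj (topS x i) *m (pid_mx (r i) : 'M_(r i, d i)).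

Lemma mxpolyfun_topS i : mxpolyfun (fun x => topS x i).
Proof.
apply: mxpolyfunM; last exact: mxpolyfun_const.
apply: mxpolyfunM; first exact: mxpolyfun_const.
exact: mxpolyfun_rep_prod.
Qed.

Lemma polyfun_topdet i : polyfun (fun x => topdet x i).
Proof. exact/polyfun_det/mxpolyfun_topS. Qed.

Lemma mxpolyfun_shear_num i : mxpolyfun (fun x => shear_num x i).
Proof.
apply: mxpolyfunM; last exact: mxpolyfun_const.
apply: mxpolyfunM; last exact/mxpolyfun_adj/mxpolyfun_topS.
apply: mxpolyfunM; last exact: mxpolyfun_const.
apply: mxpolyfunM; first exact: mxpolyfun_const.
exact: mxpolyfun_rep_prod.
Qed.

(* Cramer's rule: X i = (bottom part of A_i...A_1) * (top minor)^-1. *)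
Lemma shear_num_chart X T i : admissible X T -> (i <= N)%N ->
  shear_num (chart X T) i = topdet (chart X T) i *: X i.
Proof.
move=> aXT iN; have [EX XE] := proj1 aXT i iN.
have ri := rd iN.
set x := chart X T; set M := rep_prod x i; set H := Tprod T i.
pose Jr : 'M[C]_(r i, d i) := pid_mx (r i).
pose Jl : 'M[C]_(d i, r i) := pid_mx (r i).
pose K : 'M[C]_(d 0, r i) := pid_mx (r i).
have JlJr : Jl *m Jr = E i by rewrite pid_mx_id.
have JrE : Jr *m E i = Jr by rewrite pid_mx_id.
have ME : M = (1%:M + X i) *m H by apply: rep_prod_chart.
have SE : topS x i = Jr *m H *m K.
  rewrite /topS -/M -/K -/Jr; congr (_ *m _).
  have JX : Jr *m X i = 0 by rewrite -JrE -mulmxA EX mulmx0.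
  by rewrite ME mulmxA mulmxDr mulmx1 JX addr0.
have MK : M *m K = (1%:M + X i) *m Jl *m topS x i.
  have HE : H = Jl *m Jr *m H by rewrite JlJr (pid_Tprod aXT).
  by rewrite SE ME {1}HE !mulmxA.
rewrite /shear_num /topdet -/M -/K -/Jr; clear SE; move: (topS x i) MK => S MK.
rewrite -!mulmxA (mulmxA M) MK -!mulmxA (mulmxA S) mul_mx_adj mul_scalar_mx.
rewrite -!scalemxAr JlJr [(_ + X i) *m _]mulmxDl mul1mx XE mulmxDr mul_copid_mx_pid // add0r.
by rewrite mulmxBl mul1mx EX subr0.
Qed.

Definition X0 v : 'M[C]_(d v) := 0.
Definition T0 v : 'M[C]_(d v.+1, d v) := pid_mx (r v.+1).

Lemma admissible_base : admissible X0 T0.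
Proof.
split=> v vN; first by rewrite /X0 mulmx0 mul0mx.
have := rS vN; have := rd vN; have := rd (ltnW vN) => h1 h2 h3.
rewrite /T0 pid_mx_id //.
Qed.

Lemma Tprod_base i : (i <= N)%N -> Tprod T0 i = pid_mx (r i).
Proof.
elim: i => [_|i IH iN] /=; first by rewrite r0 pid_mx_1.
rewrite IH ?(ltnW iN) // mul_pid_mx; congr pid_mx.
have := rS iN; have := rd (ltnW iN); lia.
Qed.

Lemma rep_prod_base i : (i <= N)%N -> rep_prod (chart X0 T0) i = pid_mx (r i).
Proof.
move=> iN; rewrite (rep_prod_chart admissible_base) // Tprod_base //.
by rewrite /X0 addr0 mul1mx.
Qed.

Lemma leq_r0 i : (i <= N)%N -> (r i <= d 0)%N.
Proof.
elim: i => [_|i IH iN]; first by rewrite r0.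
exact: leq_trans (rS iN) (IH (ltnW iN)).
Qed.

Lemma topdet_base i : (i <= N)%N -> topdet (chart X0 T0) i = 1.
Proof.
move=> iN; rewrite /topdet /topS rep_prod_base // pid_mx_id ?rd //.
by rewrite pid_mx_id ?leq_r0 // pid_mx_1 det1.
Qed.

(** Entries of [X v] come from Cramer's rule. Entries of [T v] come from undoing the shears,
    [T v = (1 - X v.+1) A (1 + X v)], with both denominators cleared. All denominators are 1 at the
    base point. *)
Lemma chart_left_inv (j : chart_coord) : exists q g : (rep_coord N d -> C) -> C,
  [/\ polyfun q, polyfun g, forall t, q (chart_map t) = t j * g (chart_map t)
    & g (chart_map (params_of X0 T0)) != 0].
Proof.
have base : chart_map (params_of X0 T0) = chart X0 T0.
  have [eX eT] := params_ofK admissible_base.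
  by apply: eq_mkrep => v vN; rewrite !eX ?eT // ltnW.
case Ej: (val j) => [b [v [k l]]].
have tE (t : chart_coord -> C) : chart_entry t b v k l = t j.
  by have := chart_entry_in t j; rewrite Ej.
have : chart_mask b v k l by have := valP j; rewrite /= Ej.
case: b tE {Ej} => tE.
- rewrite /chart_mask => /and4P[vN rk kd lr].
  have ld : (l < d v)%N by apply: leq_trans lr (rd vN).
  exists (fun x => shear_num x v (Ordinal kd) (Ordinal ld)), (fun x => topdet x v).
  split; first exact: mxpolyfun_shear_num; first exact: polyfun_topdet.
    move=> t; rewrite (shear_num_chart (admissible_chart_map t) vN).
    by rewrite 2!mxE tE mulrC.
  by rewrite base topdet_base // oner_eq0.
- rewrite /chart_mask => /and4P[vN kd ld _].
  exists (fun x => (((topdet x v.+1) *: 1%:M - shear_num x v.+1) *m rep_mx x v *m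
     ((topdet x v) *: 1%:M + shear_num x v)) (Ordinal kd) (Ordinal ld)).
  exists (fun x => topdet x v.+1 * topdet x v); split.
  + apply: mxpolyfunM; first apply: mxpolyfunM.
    * apply: mxpolyfunB; last exact: mxpolyfun_shear_num.
      by apply: mxpolyfunZ; [apply: polyfun_topdet|apply: mxpolyfun_const].
    * exact: mxpolyfun_rep_mx.
    * apply: mxpolyfunD; last exact: mxpolyfun_shear_num.
      by apply: mxpolyfunZ; [apply: polyfun_topdet|apply: mxpolyfun_const].
  + by apply: polyfunM; apply: polyfun_topdet.
  + move=> t; have aXT := admissible_chart_map t.
    rewrite (shear_num_chart aXT vN) (shear_num_chart aXT (ltnW vN)) -scalerBr -scalerDr.
    rewrite -scalemxAr -!scalemxAl scalerA rep_mx_mkrep // !mulmxA.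
    rewrite (proj2 (mulmx_shear_inv (admissible_sqr aXT vN))) mul1mx -mulmxA.
    rewrite (proj2 (mulmx_shear_inv (admissible_sqr aXT (ltnW vN)))) mulmx1.
    by rewrite 2!mxE tE mulrC [_ v.+1 * _]mulrC.
  + by rewrite base !topdet_base ?(ltnW vN) // mulr1 oner_eq0.
Qed.

Lemma zdim_chart : zdim (zclosure (prange chart_map)) #|chart_coord|.
Proof. exact: zdim_zclosure_prange polymap_chart_map chart_left_inv. Qed.

(** If the rank at [x] exceeded [r i], a suitable determinant would be 1 at [x] and yet vanish on
    the whole image of the chart. *)
Lemma zclosure_chart_rank x i : (i <= N)%N -> zclosure (prange chart_map) x ->
  (\rank (rep_prod x i) <= r i)%N.
Proof.
move=> iN cx; rewrite leqNgt; apply/negP => lt.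
have [L [R LR]] := exists_unit_sandwich (rep_prod x i).
have : \det (L *m rep_prod x i *m R) = 0.
  apply: (@zclosure_poly0 _ (prange chart_map)
    (fun y => \det (L *m rep_prod y i *m R)) _ _ x cx).
    apply: polyfun_det; apply: mxpolyfunM; last exact: mxpolyfun_const.
    by apply: mxpolyfunM; [apply: mxpolyfun_const|apply: mxpolyfun_rep_prod].
  move=> _ [t <-]; apply: rank_lt_det0; apply: leq_ltn_trans lt.
  exact: rank_rep_prod_chart (admissible_chart_map t) _ iN.
by rewrite LR det1 => /eqP; rewrite oner_eq0.
Qed.

(** A point with exactly these ranks tells the closures of different strata apart. *)
Lemma zclosure_chart_base : exists2 x, zclosure (prange chart_map) x &
  forall i, (i <= N)%N -> \rank (rep_prod x i) = r i.
Proof.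
exists (chart X0 T0); first exact/sub_zclosure/prange_chart_map/admissible_base.
by move=> i iN; rewrite rep_prod_base // rank_pid_mx ?rd ?leq_r0.
Qed.

Hypothesis rN : r N = 0%N.

Lemma zclosure_chart_Sigma0 x : zclosure (prange chart_map) x -> Sigma0 N d x.
Proof.
move/(zclosure_chart_rank (leqnn N)); rewrite rN leqn0 mxrank_eq0 => /eqP.
by [].
Qed.

End Stratum.

(** * Each stratum lies in the closure of its chart *)

Lemma rank_path m n (P Q : 'M[C]_(m, n)) : exists q : {poly C},
  q != 0 /\ forall t, q.[t] != 0 -> (\rank (P + Q)%R <= \rank (P + t *: Q)%R)%N.
Proof.
(* A determinant that equals 1 at [t = 1] yields [q]; where it does not vanish, the rank cannot
   drop. *)
have [L [R LR]] := exists_unit_sandwich (P + Q).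
pose F (y : unit -> C) := \det (L *m (P + y tt *: Q) *m R).
have pF : polyfun F.
  apply: polyfun_det; apply: mxpolyfunM; last exact: mxpolyfun_const.
  apply: mxpolyfunM; first exact: mxpolyfun_const.
  apply: mxpolyfunD; first exact: mxpolyfun_const.
  by apply: mxpolyfunZ; [apply: polyfun_var|apply: mxpolyfun_const].
have [q Hq] := polyfun_curve (fun=> 'X) pF; exists q; split.
  apply/eqP => q0; have := Hq 1; rewrite q0 horner0 /F hornerX scale1r LR det1.
  by move/esym/eqP; rewrite oner_eq0.
move=> t; rewrite Hq /F hornerX => nz; rewrite leqNgt; apply: contra nz => lt.
exact/eqP/rank_lt_det0.
Qed.

Lemma dep_choice (T : nat -> Type) (P : forall v, T v -> Prop) :
  (forall v, exists x, P v x) -> exists f, forall v, P v (f v).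
Proof.
move=> H; exists (fun v => proj1_sig (constructive_indefinite_description _ (H v))).
by move=> v; apply: proj2_sig.
Qed.

Section StratumClosure.
Variables (N : nat) (d r : nat -> nat).
Hypothesis r0 : r 0 = d 0.
Hypothesis rS : forall i, (i < N)%N -> (r i.+1 <= r i)%N.
Hypothesis rd : forall i, (i <= N)%N -> (r i <= d i)%N.

Notation E v := (pid_mx (r v) : 'M[C]_(d v)).

(** Clearing the lower rows of each partial product by [1 - X v] leaves [H v], whose column space is
    spanned by the first [r v] basis vectors. Since [T v *m H v = H v.+1], each [T v] has the shape
    required by the chart. *)
Lemma generic_in_chart (x : rep_coord N d -> C) :
  (forall i, (i <= N)%N -> \rank (rep_prod x i) = r i) ->
  (forall i, (i <= N)%N -> \rank (E i *m rep_prod x i) = r i) ->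
  prange (chart_map (N := N) (d := d) (r := r)) x.
Proof.
move=> rk rkE.
have HX v : exists X : 'M[C]_(d v), (v <= N)%N ->
    [/\ E v *m X = 0, X *m E v = X & copid_mx (r v) *m rep_prod x v = X *m rep_prod x v].
  case: (leqP v N) => vN; last by exists 0.
  have [|X HX] := @exists_shear_lower _ _ _ (r v) (rep_prod x v) (rd vN).
    by rewrite rk ?rkE.
  by exists X.
have {HX} [X HX] := dep_choice HX.
have XX v : (v <= N)%N -> X v *m X v = 0.
  by move=> /HX [EX XE _]; rewrite -{1}XE -mulmxA EX mulmx0.
pose T v := (1%:M - X v.+1) *m rep_mx x v *m (1%:M + X v).
pose H v := (1%:M - X v) *m rep_prod x v.
have cH v : (v <= N)%N -> copid_mx (r v) *m H v = 0.
  move=> /HX [EX XE cM]; rewrite /H mulmxA mulmxBr mulmx1.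
  by rewrite [copid_mx (r v) *m X v]mulmxBl mul1mx EX subr0 mulmxBl cM subrr.
have EH v : (v <= N)%N -> E v *m H v = H v.
  by move=> /cH; rewrite mulmxBl mul1mx => /eqP; rewrite subr_eq0 => /eqP.
have rH v : (v <= N)%N -> \rank (H v) = r v.
  move=> vN; rewrite -(EH v vN) /H mulmxA mulmxBr mulmx1.
  by case: (HX v vN) => -> _ _; rewrite subr0 rkE.
have aXT : admissible N r X T.
  split=> v vN; first by case: (HX v vN).
  apply/eqP; rewrite eq_sym -subr_eq0 -[X in X - _]mul1mx -mulmxA -mulmxBl.
  apply/eqP; rewrite mulmxA; apply: (mulmx_pid_eq0 (H := H v)).
  - exact: rd (ltnW vN).
  - exact: EH (ltnW vN).
  - exact: rH (ltnW vN).
  rewrite /T /H -!mulmxA (mulmxA (1%:M + X v)).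
  rewrite (proj1 (mulmx_shear_inv (XX v (ltnW vN)))) mul1mx.
  exact: cH v.+1 vN.
have -> : x = chart (N := N) X T; last exact: prange_chart_map aXT.
rewrite -[LHS]mkrep_rep_mx; apply: eq_mkrep => v vN; rewrite /T.
rewrite !mulmxA (proj1 (mulmx_shear_inv (XX v.+1 vN))) mul1mx -mulmxA.
by rewrite (proj1 (mulmx_shear_inv (XX v (ltnW vN)))) mulmx1.
Qed.

(* Any point of the stratum is moved into the chart by the shears 1 + t X v, for all
   but finitely many t; the point itself is reached at t = 0. *)
Lemma stratum_sub_zclosure_chart (x : rep_coord N d -> C) :
  (forall i, (i <= N)%N -> \rank (rep_prod x i) = r i) ->
  zclosure (prange (chart_map (N := N) (d := d) (r := r))) x.
Proof.
move=> rk.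
have HX v : exists X : 'M[C]_(d v), (v <= N)%N ->
    [/\ E v *m X = X, X *m E v = 0
      & \rank (E v *m rep_prod x v + X *m rep_prod x v)%R = r v].
  case: (leqP v N) => vN; last by exists 0.
  by have := exists_shear_upper (rep_prod x v); rewrite rk // => -[X HX]; exists X.
have {HX} [X HX] := dep_choice HX.
have XX t v : (v <= N)%N -> (t *: X v) *m (t *: X v) = 0.
  move=> /HX [EX XE _].
  by rewrite -scalemxAl -scalemxAr -{2}EX mulmxA XE mul0mx !scaler0.
have X00 : X 0 = 0 by have [_ + _] := HX 0%N isT; rewrite r0 pid_mx_1 mulmx1.
pose xt (t : C) : rep_coord N d -> C :=
  mkrep (fun v => (1%:M + t *: X v.+1) *m rep_mx x v *m (1%:M - t *: X v)).
have prodE t i : (i <= N)%N -> rep_prod (xt t) i = (1%:M + t *: X i) *m rep_prod x i.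
  elim: i => [_|i IH iN] /=; first by rewrite X00 scaler0 addr0 mul1mx.
  rewrite IH ?(ltnW iN) // rep_mx_mkrep // -!mulmxA; congr (_ *m _); congr (_ *m _).
  by rewrite mulmxA (proj2 (mulmx_shear_inv (XX t i (ltnW iN)))) mul1mx.
have [Q HQ] := fin_all_exists (fun v : 'I_N.+1 =>
  rank_path (E v *m rep_prod x v) (X v *m rep_prod x v)).
pose q := \prod_v Q v.
have qn0 : q != 0 by apply/prodf_neq0 => v _; case: (HQ v).
have good t : q.[t] != 0 -> prange (chart_map (N := N) (d := d) (r := r)) (xt t).
  rewrite horner_prod => /prodf_neq0 Qt.
  have rkt i : (i <= N)%N -> \rank (rep_prod (xt t) i) = r i.
    move=> iN; rewrite prodE // -(rk i iN); apply/eqP; rewrite eqn_leq mxrankM_maxr /=.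
    have {1}<- : (1%:M - t *: X i) *m ((1%:M + t *: X i) *m rep_prod x i) = rep_prod x i.
      by rewrite mulmxA (proj2 (mulmx_shear_inv (XX t i iN))) mul1mx.
    exact: mxrankM_maxr.
  apply: generic_in_chart => // i iN; apply/eqP; rewrite eqn_leq; apply/andP; split.
    by rewrite (leq_trans (mxrankM_maxl _ _)) // rank_pid_mx ?rd.
  have [EX _ rkX] := HX i iN.
  rewrite prodE // mulmxA mulmxDr mulmx1 -scalemxAr EX mulmxDl -scalemxAl -{1}rkX.
  have [_] := HQ (Ordinal (iN : (i < N.+1)%N)); apply.
  exact: Qt.
have xt0 : xt 0 = x.
  rewrite -[RHS]mkrep_rep_mx; apply: eq_mkrep => v vN.
  by rewrite !scale0r addr0 subr0 mul1mx mulmx1.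
move=> p p0; rewrite -xt0.
have pF : polyfun (fun y : unit -> C => peval p (xt (y tt))).
  apply: (@polyfun_comp _ _ (fun y : unit -> C => xt (y tt))); last exact: polyfun_peval.
  apply: polymap_mkrep => v vN; apply: mxpolyfunM; first apply: mxpolyfunM.
  - apply: mxpolyfunD; first exact: mxpolyfun_const.
    by apply: mxpolyfunZ; [apply: polyfun_var|apply: mxpolyfun_const].
  - exact: mxpolyfun_const.
  - apply: mxpolyfunB; first exact: mxpolyfun_const.
    by apply: mxpolyfunZ; [apply: polyfun_var|apply: mxpolyfun_const].
have [P HP] := polyfun_curve (fun=> 'X) pF.
(* Along the path [p] vanishes wherever [q] does not, so the product vanishes identically and [q]
   can be cancelled. *)
have Pq0 : P * q = 0.
  apply: horner_eq0_all => t; rewrite hornerM HP hornerX.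
  case: (eqVneq q.[t] 0) => [->|/good/p0 ->]; [exact: mulr0|exact: mul0r].
have P0 : P = 0 by apply/eqP; move/eqP: Pq0; rewrite mulf_eq0 (negbTE qn0) orbF.
by have := HP 0; rewrite P0 horner0 hornerX.
Qed.

End StratumClosure.

(** * The number of chart coordinates *)

Local Open Scope nat_scope.

Lemma sum_ord_interval m a b : b <= m -> \sum_(k < m) ((a <= k) && (k < b) : nat) = b - a.
Proof.
elim: m b => [|m IH] b bm; first by rewrite big_ord0; lia.
rewrite big_ord_recr /=; case: (ltnP m b) => mb.
  have -> : b = m.+1 by lia.
  transitivity (\sum_(k < m) ((a <= k) && (k < m) : nat) + (a <= m)).
    congr (_ + _); last by rewrite andbT.
    by apply: eq_bigr => k _; rewrite (ltn_ord k) (leqW (ltn_ord k)).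
  by rewrite IH //; case: leqP; lia.
by rewrite IH // andbF addn0.
Qed.

Lemma sum_rect m a b c : b <= m -> c <= m ->
  \sum_(k < m) \sum_(l < m) ([&& a <= k, k < b & l < c] : nat) = (b - a) * c.
Proof.
move=> bm cm; rewrite -(sum_ord_interval a bm).
have := sum_ord_interval 0 cm; rewrite subn0 => {2}<-.
rewrite big_distrlr /=; apply: eq_bigr => k _; apply: eq_bigr => l _.
by rewrite mulnb andbA.
Qed.

(** [X v] has [(d v - r v) * r v] parameters, and [T v] misses [(d v.+1 - r v.+1) * r v] of its
    [d v.+1 * d v] entries. Pairing [X v.+1] with [T v] leaves the defect
    [(d v.+1 - r v.+1) * (r v - r v.+1)], and [X 0] contributes nothing. *)
Lemma card_chart_coord N d r : r 0 = d 0 ->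
  (forall i, i < N -> r i.+1 <= r i) -> (forall i, i <= N -> r i <= d i) ->
  #|chart_coord N d r| + rank_codim N d r = \sum_(i < N) d i.+1 * d i.
Proof.
move=> r0 rS rd; set B := chart_bound N d.
have dB v : v <= N -> d v <= B by apply: leq_dB.
have NB : N <= B by apply: leq_addr.
pose F v := \sum_(k < B.+1) \sum_(l < B.+1) (chart_mask N d r true v k l : nat).
pose G v := \sum_(k < B.+1) \sum_(l < B.+1) (chart_mask N d r false v k l : nat).
have -> : #|chart_coord N d r| = \sum_(v < B.+1) F v + \sum_(v < B.+1) G v.
  rewrite card_sig -sum1_card big_mkcond /=.
  transitivity (\sum_(c : bool * ('I_B.+1 * ('I_B.+1 * 'I_B.+1)))
      (chart_mask N d r c.1 c.2.1 c.2.2.1 c.2.2.2 : nat)).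
    by apply: eq_bigr => c _; rewrite inE; case: chart_mask.
  rewrite -(pair_bigA _ (fun b (c : 'I_B.+1 * ('I_B.+1 * 'I_B.+1)) =>
    (chart_mask N d r b c.1 c.2.1 c.2.2 : nat))) /= big_bool /=.
  congr (_ + _).
  + rewrite -(pair_bigA _ (fun (v : 'I_B.+1) (c : 'I_B.+1 * 'I_B.+1) =>
      (chart_mask N d r true v c.1 c.2 : nat))) /=.
    apply: eq_bigr => v _.
    by rewrite -(pair_bigA _ (fun k l : 'I_B.+1 => (chart_mask N d r true v k l : nat))).
  + rewrite -(pair_bigA _ (fun (v : 'I_B.+1) (c : 'I_B.+1 * 'I_B.+1) =>
      (chart_mask N d r false v c.1 c.2 : nat))) /=.
    apply: eq_bigr => v _.
    by rewrite -(pair_bigA _ (fun k l : 'I_B.+1 => (chart_mask N d r false v k l : nat))).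
have FE v : v <= N -> F v = (d v - r v) * r v.
  move=> vN; rewrite /F /chart_mask vN /= sum_rect ?leqW ?dB //.
  exact: leq_trans (rd v vN) (dB v vN).
have GE v : v < N -> G v + (d v.+1 - r v.+1) * r v = d v.+1 * d v.
  move=> vN; rewrite /G /chart_mask vN /=.
  have dv := dB v (ltnW vN); have dv' := dB v.+1 vN; have rv := rd v (ltnW vN).
  rewrite -(@sum_rect B.+1) ?leqW //; last exact: leq_trans rv dv.
  rewrite -[d v.+1 in RHS]subn0 -(@sum_rect B.+1) ?leqW // -big_split /=.
  apply: eq_bigr => k _; rewrite -big_split /=; apply: eq_bigr => l _.
  case: (leqP (r v.+1) k) => /= kr; last by rewrite andbT addn0.
  case: (ltnP k (d v.+1)) => //= kd; case: (ltnP l (r v)) => lr /=.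
    by rewrite andbF (leq_trans lr rv).
  by rewrite andbT addn0.
have F0 v : N < v -> F v = 0.
  move=> vN; rewrite /F big1 // => k _; rewrite big1 // => l _.
  by rewrite /chart_mask leqNgt vN.
have G0 v : N <= v -> G v = 0.
  move=> vN; rewrite /G big1 // => k _; rewrite big1 // => l _.
  by rewrite /chart_mask ltnNge vN.
have -> : \sum_(v < B.+1) F v = \sum_(i < N) (d i.+1 - r i.+1) * r i.+1.
  transitivity (\sum_(v < N.+1) F v).
    rewrite (@big_ord_widen _ _ _ N.+1 B.+1 F) // [RHS]big_mkcond; apply: eq_bigr => v _.
    by case: ltnP => // /F0.
  rewrite big_ord_recl FE // r0 subnn mul0n add0n; apply: eq_bigr => i _.
  exact: (FE i.+1 (ltn_ord i)).
have -> : \sum_(v < B.+1) G v = \sum_(i < N) G i.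
  rewrite (@big_ord_widen _ _ _ N B.+1 G) ?leqW // [RHS]big_mkcond; apply: eq_bigr => v _.
  by case: ltnP => // /G0.
rewrite /rank_codim -!big_split /=; apply: eq_bigr => i _.
rewrite -(GE i (ltn_ord i)) addnAC -mulnDr addnC; congr (_ + _ * _).
by rewrite subnKC ?rS.
Qed.

(** * The strata of the zero-product variety *)

Section Strata.
Variables (N : nat) (d : nat -> nat).

Let ds := [seq d i.+1 | i <- iota 0 N].

Let size_ds : size ds = N. Proof. by rewrite size_map size_iota. Qed.

Let nth_ds i : i < N -> nth 0 ds i = d i.+1.
Proof. by move=> iN; rewrite (nth_map 0) ?size_iota // nth_iota. Qed.

Definition strata := rank_seqs (d 0) ds.

(** Restores [r_0 = d_0], which the lists in [strata] omit. *)
Definition rank_fun (rs : seq nat) := nth 0 (d 0 :: rs).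

Lemma mem_strata rs (r := rank_fun rs) : rs \in strata <->
  [/\ size rs = N, forall i, i < N -> r i.+1 <= r i, forall i, i <= N -> r i <= d i
    & r N = 0].
Proof.
rewrite /strata mem_rank_seqs size_ds; split=> -[sz H1 H2 H3]; split=> //.
  by case=> [_|i iN]; rewrite // -nth_ds //; apply: H2.
by move=> i iN; rewrite nth_ds //; apply: H2.
Qed.

Lemma count_strata v :
  count (fun rs => rank_codim N d (rank_fun rs) == v) strata = nstrata (d 0) ds v.
Proof.
rewrite -count_rank_seqs; apply: eq_count => rs; rewrite /rank_codim size_ds.
by congr (_ == _); apply: eq_bigr => i _; rewrite [nth 0 (_ :: ds) _]/= nth_ds.
Qed.

Definition stratum_closure (rs : seq nat) : aset (rep_coord N d) :=
  zclosure (prange (chart_map (N := N) (d := d) (r := rank_fun rs))).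

(** A point of [Sigma0] lies in the stratum given by the ranks of its own partial products;
    conversely, the bound [r N = 0] persists on the closure. *)
Lemma Sigma0_strata x :
  Sigma0 N d x <-> exists2 rs, rs \in strata & stratum_closure rs x.
Proof.
split=> [x0|[rs /mem_strata [_ rS rd rN]]]; last first.
  exact: zclosure_chart_Sigma0.
pose rs := mkseq (fun i => \rank (rep_prod x i.+1)) N.
have rE i : i <= N -> \rank (rep_prod x i) = rank_fun rs i.
  by case: i => [_|i iN]; rewrite /rank_fun /= ?mxrank1 ?nth_mkseq.
have rsL : rs \in strata.
  apply/mem_strata; split; first by rewrite size_mkseq.
  - by move=> i iN; rewrite -!rE ?(ltnW iN) //=; apply: mxrankM_maxr.
  - by move=> i iN; rewrite -rE // rank_leq_row.
  - by rewrite -rE // (x0 : rep_prod x N = 0%R) mxrank0.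
exists rs => //; have /mem_strata [_ rS rd rN] := rsL.
exact: stratum_sub_zclosure_chart.
Qed.

Lemma zdim_stratum_closure rs : rs \in strata ->
  zdim (stratum_closure rs) #|chart_coord N d (rank_fun rs)|.
Proof. by move=> /mem_strata [_ rS rd rN]; apply: zdim_chart. Qed.

Lemma zirreducible_stratum_closure rs : zirreducible (stratum_closure rs).
Proof. exact/zirreducible_zclosure_prange/polymap_chart_map. Qed.

(** A closure contains a point with exactly its own ranks; lying in the other closure bounds these
    by the other rank sequence. Symmetry gives equality. *)
Lemma stratum_closure_inj : {in strata &, injective stratum_closure}.
Proof.
have le rs rs' : rs \in strata -> rs' \in strata ->
    stratum_closure rs = stratum_closure rs' ->
    forall i, i <= N -> rank_fun rs i <= rank_fun rs' i.
  move=> /mem_strata [_ rS rd rN] /mem_strata [_ rS' rd' rN'] e i iN.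
  have [//|//|//|x cx <- //] := @zclosure_chart_base N d (rank_fun rs).
  by apply: zclosure_chart_rank => //; rewrite -/(stratum_closure rs') -e.
move=> rs rs' Hrs Hrs' e.
have [sz _ _ _] := proj1 (mem_strata _) Hrs.
have [sz' _ _ _] := proj1 (mem_strata _) Hrs'.
apply: (@eq_from_nth _ 0); first by rewrite sz.
move=> i; rewrite sz => iN; apply/eqP; rewrite eqn_leq.
by rewrite (le rs rs' _ _ e i.+1) ?(le rs' rs _ _ (esym e) i.+1).
Qed.

Lemma zdim_Rep : zdim (Rep N d) (\sum_(i < N) d i.+1 * d i).
Proof.
have -> : \sum_(i < N) d i.+1 * d i = #|rep_coord N d|.
  rewrite card_tagged sumnE big_map big_enum /=; apply: eq_bigr => i _.
  by rewrite card_prod !card_ord.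
have <- : zclosure (prange (fun x : rep_coord N d -> C => x)) = Rep N d.
  by apply: aset_eq => // x _; apply: sub_zclosure; exists x.
apply: (zdim_zclosure_prange (t0 := fun=> 0%R)).
  by move=> j; apply: polyfun_var.
move=> j; exists (fun x => x j), (fun=> 1%R); split.
- exact: polyfun_var.
- exact: polyfun_const.
- by move=> t; rewrite mulr1.
- exact: oner_neq0.
Qed.

Variable m : nat.
Hypothesis min_m : is_min_value N d m.

Let D0 := dsort N d 0.

Lemma min_minimizers_gt0 : 0 < #|minimizers N d m|.
Proof.
have [[e [fe Ge]] _] := min_m; apply/card_gt0P.
(* Feasibility bounds each entry by [d'_0], so [e] fits into the finite type of [minimizers]. *)
have eD i : e i <= D0.
  by rewrite -[X in _ <= X](fe : _ = D0) (bigD1 i) //= leq_addr.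
exists [ffun i => inord (e i)].
have eE (i : 'I_N) : ([ffun i => inord (e i)] : {ffun 'I_N -> 'I_D0.+1}) i = e i :> nat.
  by rewrite ffunE inordK ?ltnS ?eD.
rewrite inE; apply/andP; split; apply/eqP.
  by rewrite -[RHS]fe; apply: eq_bigr => i _.
rewrite -Ge; apply: eq_bigr => i _; apply: eq_bigr => j _; by rewrite !eE.
Qed.

Lemma lt_min_minimizers w : w < m -> #|minimizers N d w| = 0.
Proof.
move=> wm; apply/eqP; rewrite cards_eq0; apply/eqP/setP => e; rewrite !inE.
apply/negP => /andP[/eqP fe /eqP Ge].
have [_ /(_ _ fe)] := min_m; rewrite leqNgt => /negP; apply; by rewrite Ge.
Qed.

(** For the sorted vector nothing lies below the minimum; [eqlead] carries this vanishing over to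
    [d] itself. *)
Lemma count_strata_lt_min w : w < m ->
  count (fun rs => rank_codim N d (rank_fun rs) == w) strata = 0.
Proof.
rewrite count_strata; move: w.
apply: (@eqlead_eq0 _ _ m (@eqlead_nstrata_dsort N d)) => u um.
by rewrite -card_minimizers lt_min_minimizers.
Qed.

Lemma count_strata_min :
  count (fun rs => rank_codim N d (rank_fun rs) == m) strata = #|minimizers N d m|.
Proof.
rewrite count_strata card_minimizers; apply: eqlead_nstrata_dsort => w wm.
by rewrite -card_minimizers lt_min_minimizers // -count_strata count_strata_lt_min.
Qed.

Lemma leq_min_codim rs : rs \in strata -> m <= rank_codim N d (rank_fun rs).
Proof.
move=> rsL; rewrite leqNgt; apply/negP => /count_strata_lt_min/eqP.
by rewrite eqn0Ngt -has_count => /hasP; apply; exists rs.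
Qed.

End Strata.
Arguments stratum_closure : clear implicits.

(** * Dimension and top-dimensional components of the zero-product variety *)

Theorem theorem6 (N : nat) (d : nat -> nat) (m : nat) :
  (1 <= N)%N ->
  is_min_value N d m ->
  (* codim of Sigma^0_d in Rep_d equals the minimum value *)
  (exists dimRep dimSigma : nat,
      zdim (Rep N d) dimRep /\ zdim (Sigma0 N d) dimSigma /\
      dimRep = (dimSigma + m)%N) /\
  (* the number of top-dimensional irreducible components equals the number of minimizers *)
  (exists dimSigma : nat, zdim (Sigma0 N d) dimSigma /\
     exists comp : 'I_#|minimizers N d m| -> aset (rep_coord N d),
       injective comp /\
       (forall Z : aset (rep_coord N d),
          (irr_component (Sigma0 N d) Z /\ zdim Z dimSigma) <-> exists k, comp k = Z)).
Proof.
move=> _ min_m; pose dimRep := \sum_(i < N) d i.+1 * d i.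
pose cod rs := rank_codim N d (rank_fun d rs).
pose top := [seq rs <- strata N d | cod rs == m].
have size_top : size top = #|minimizers N d m|.
  by rewrite size_filter count_strata_min.
have dimE rs : rs \in strata N d -> #|chart_coord N d (rank_fun d rs)| + cod rs = dimRep.
  by move=> /mem_strata [_ rS rd rN]; apply: card_chart_coord.
have [rs0 rs0L cod0] : exists2 rs, rs \in strata N d & cod rs = m.
  have : 0 < size top by rewrite size_top min_minimizers_gt0.
  rewrite size_filter -has_count => /hasP[rs rsL /eqP]; by exists rs.
(* The dimension is that of a stratum of minimal codimension [m]. *)
pose n := #|chart_coord N d (rank_fun d rs0)|.
have nE : dimRep = n + m by rewrite -(dimE _ rs0L) cod0.
have len rs : rs \in strata N d -> #|chart_coord N d (rank_fun d rs)| <= n.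
  move=> rsL; rewrite -(leq_add2r m) -nE -(dimE _ rsL) leq_add2l.
  exact: leq_min_codim.
have irr rs : rs \in strata N d -> zirreducible (stratum_closure N d rs).
  by move=> _; apply: zirreducible_stratum_closure.
have dim rs := @zdim_stratum_closure N d rs.
have dimS : zdim (Sigma0 N d) n.
  exact: (zdim_finite_union irr dim (@Sigma0_strata N d) len rs0L).
split; first by exists dimRep, n; split=> //; apply: zdim_Rep.
exists n; split=> //.
have lt_top (k : 'I_#|minimizers N d m|) : k < size top by rewrite size_top.
(* Components are enumerated by the rank sequences of codimension [m], and distinct sequences have
   distinct closures. *)
exists (fun k => stratum_closure N d (nth [::] top k)); split.
  move=> k k' e; apply: val_inj; apply/eqP.
  have mem_top (i : 'I_#|minimizers N d m|) : nth [::] top i \in strata N d.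
    by have := mem_nth [::] (lt_top i); rewrite mem_filter => /andP[].
  rewrite -(nth_uniq [::] (lt_top k) (lt_top k')) ?filter_uniq ?uniq_rank_seqs //.
  by apply/eqP; apply: stratum_closure_inj e.
move=> Z; rewrite (top_component_finite_union irr dim (@Sigma0_strata N d) Z dimS).
split=> [[rs rsL [Dn <-]]|[k <-]].
  have rs_top : rs \in top.
    rewrite mem_filter rsL andbT; apply/eqP/(@addnI n).
    by rewrite -nE -(dimE _ rsL) Dn.
  have lt : index rs top < #|minimizers N d m| by rewrite -size_top index_mem.
  by exists (Ordinal lt); rewrite /= nth_index.
have := mem_nth [::] (lt_top k); rewrite mem_filter => /andP[/eqP ck rsL].
exists (nth [::] top k) => //; split=> //.
by apply: (@addIn m); rewrite -nE -(dimE _ rsL) ck.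
Qed.
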